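(* There exist absolute constants $C>0$ and $N_0$ such that for all integers $N\ge N_0$, the number of ordered pairs of integers $(\alpha,\beta)$ with $1<|\alpha|\le N$ and $1<|\beta|\le N$ that are not special is at most $C N^{3/2}\log N$.
   Context: For a prime $p$, $v_p(\cdot)$ denotes the $p$-adic valuation. For $\gamma\in\mathbb{Q}$ with $v_p(\gamma)=0$ and $p$ odd, $\left(\frac{\gamma}{p}\right)$ denotes the Legendre symbol of $\gamma$ modulo $p$. A pair $\alpha,\beta\in\mathbb{Q}^{\times}\setminus\{\pm1\}$ is called special if there are infinitely many odd primes $p$ such that (a) $v_p(\alpha)=v_p(\beta)=0$, (b) $v_p(\alpha^{2k}-\beta)\ge 1$ for some integer $k$, and (c) $\left(\frac{\alpha}{p}\right)=-1$. *)

(* Defs.v *)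
From mathcomp Require Export all_boot all_order all_algebra finmap.
From mathcomp Require Export all_classical all_reals all_analysis.

Set Implicit Arguments.
Unset Strict Implicit.
Unset Printing Implicit Defensive.

Import Order.TTheory GRing.Theory Num.Theory.

Local Open Scope classical_set_scope.
Local Open Scope ring_scope.

(* The value at 0 is +oo, so that padic_val p (x - y) >= 1 also covers x = y. *)
Definition padic_val (p : nat) (x : rat) : \bar int :=
  if x == 0 then +oo%E
  else ((logn p `|numq x|)%:Z - (logn p `|denq x|)%:Z)%:E.

(* [ratr x : 'F_p] is numq x / denq x computed in the prime field, so it is the
   reduction of x modulo p when p is a prime not dividing denq x; the symbol is
   meant to be used only for odd primes p with padic_val p x = 0. *)
Definition legendre (p : nat) (x : rat) : int :=
  let r : 'F_p := ratr x in
  if r == 0 then 0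
  else if [exists y : 'F_p, y ^+ 2 == r] then 1 else -1.

(* The exponent 2 * k is an integer, possibly negative. *)
Definition special_prime (a b : rat) (p : nat) : Prop :=
  [/\ prime p, odd p,
      padic_val p a = 0%:E /\ padic_val p b = 0%:E,
      exists k : int, (1%:E <= padic_val p (a ^ (2 * k) - b)%R)%E
    & legendre p a = -1].

Definition special (a b : rat) : Prop :=
  [/\ a \notin [:: 0; 1; -1], b \notin [:: 0; 1; -1]
    & infinite_set [set p | special_prime a b p]].

Definition nonspecial_pairs (N : int) : set (int * int) :=
  [set ab | [/\ 1 < `|ab.1| <= N, 1 < `|ab.2| <= N
              & ~ special ab.1%:~R ab.2%:~R]].

(* Hence [fset_set (nonspecial_pairs N)] is never the default value set0 that
   fset_set takes on infinite sets. *)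
Lemma finite_nonspecial_pairs (N : int) : finite_set (nonspecial_pairs N).
Proof.
have finI : finite_set [set x : int | `|x| <= N].
  apply: (@sub_finite_set _ _ ((fun n : nat => n%:Z) @` `I_(`|N|.+1) `|`
                               (fun n : nat => - n%:Z) @` `I_(`|N|.+1))).
    move=> x /= xN; have xN' : (`|x| < `|N|.+1)%N.
      by rewrite ltnS -lez_nat !abszE (le_trans xN) ?ler_norm.
    case: (leP 0 x) => x0; [left|right]; exists `|x|%N => //.
      by rewrite abszE ger0_norm.
    by rewrite abszE ltr0_norm ?opprK.
  by rewrite finite_setU; split; apply: finite_image; exact: finite_II.
apply: sub_finite_set (finite_setX finI finI).
by move=> [a b] /= [/andP[_ ?] /andP[_ ?] _].
Qed.

(* Main.v *)
Require Import Defs.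
From mathcomp Require Import cyclic finfield zify ring lra.

(** Call p a witness for (a, b) if p is odd, a is a nonresidue modulo p and p
    divides a^(2k) - b for some k.  Suppose that there are finitely many
    witnesses and that p0 is one of them with p0^2 not dividing a^(p0-1) - 1.
    Then k can be moved so that the p0-adic valuation of a^(2k) - b goes up by
    one while the class of a^(2k) - b modulo a high power of 2a and of all the
    other witnesses is unchanged.  After removal of the part supported on 2a
    and on the other witnesses, the Jacobi symbol of a modulo what remains is
    (-1)^v with v the p0-adic valuation, yet by reciprocity it depends only on
    a class modulo 4a: a contradiction.  So a single non-Wieferich witness
    makes the pair special.

    Let P consist of K >> sqrt N / log N primes p << sqrt N with phi(p-1) >> p;
    it exists because Chebyshev-type bounds for primes congruent to 1 modulo q
    make the sum of 1/q over the primes q dividing p - 1 bounded on average.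
    By the large sieve, for all but O(N/K) values of a, a positive proportion
    of P has a as a primitive root, and by a first-moment bound only O(N/K)
    values of a have many Wieferich primes in P.  For the remaining a, the large sieve again
    shows that all but O(N/K) values of b are nonzero squares, that is powers
    of a^2, modulo one of those primes. *)

Set Implicit Arguments.
Unset Strict Implicit.
Unset Printing Implicit Defensive.

Import Order.TTheory GRing.Theory Num.Theory.
Local Open Scope classical_set_scope.
Local Open Scope ring_scope.

(** * The Gauss-Schering symbol and its periodicity *)

Local Open Scope nat_scope.

Definition upper (n x : nat) : bool := n < 2 * (x %% n).

(** The representative of x up to sign modulo n in the half-system 0, ..., n/2. *)
Definition fold_half (n x : nat) : nat :=
  if upper n x then n - x %% n else x %% n.

(* [true] stands for the value -1 of the Jacobi symbol (a/n): Gauss's lemma, in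
   Schering's form for a composite odd n. *)
Definition gauss_sign (a n : nat) : bool :=
  \big[addb/false]_(1 <= x < n./2.+1) (upper n x (+) upper n (a * x)).

Lemma upper_eqmod n x y : x = y %[mod n] -> upper n x = upper n y.
Proof. by rewrite /upper => ->. Qed.

Lemma dvdn_upper n x : n %| x -> upper n x = false.
Proof. by rewrite /upper => /eqP ->. Qed.

Lemma upper_opp n x y : odd n -> n %| x + y -> ~~ (n %| x) ->
  upper n y = ~~ upper n x.
Proof.
move=> on dxy dx; rewrite /upper.
have n0 : 0 < n by case: (n) on.
have lx := ltn_pmod x n0; have ly := ltn_pmod y n0.
have x0 : 0 < x %% n by rewrite lt0n; exact: dx.
have : n %| x %% n + y %% n by rewrite /dvdn modnDm.
case/dvdnP => q qE.
have q1 : q = 1 by nia.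
by move: qE on; rewrite q1 mul1n; lia.
Qed.

Lemma fold_halfP n x : 0 < n ->
  (fold_half n x = x %[mod n]) \/ (n %| fold_half n x + x).
Proof.
move=> n0; rewrite /fold_half; case: ifP => _; last by left; rewrite modn_mod.
right; rewrite {2}(divn_eq x n) addnCA dvdn_addr ?dvdn_mull //.
by rewrite subnK // ltnW // ltn_pmod.
Qed.

Lemma fold_half_range n x : odd n -> ~~ (n %| x) ->
  1 <= fold_half n x < n./2.+1.
Proof.
move=> on dx; have n0 : 0 < n by case: (n) on.
have lx := ltn_pmod x n0.
have x0 : 0 < x %% n by rewrite lt0n; exact: dx.
by rewrite /fold_half /upper; case: ifP; lia.
Qed.

Lemma dvdn_fold_half n d x : 0 < n -> d %| n -> (d %| fold_half n x) = (d %| x).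
Proof.
move=> n0 dn; case: (fold_halfP x n0) => [/eqP h|/(dvdn_trans dn) h].
  have := modn_dvdm (fold_half n x) dn; rewrite (eqP h) modn_dvdm // => E.
  by rewrite /dvdn E.
by apply/idP/idP => H; [rewrite -(dvdn_addr _ H)|rewrite -(dvdn_addl _ H)].
Qed.

(** If a x and a y agree up to sign modulo n, then n divides x - y or x + y; for x and y between 1
    and (n-1)/2 this forces x = y. An injective self-map of a finite set is a permutation. *)
Lemma perm_fold_half n a : odd n -> coprime a n ->
  perm_eq [seq fold_half n (a * x) | x <- index_iota 1 n./2.+1]
          (index_iota 1 n./2.+1).
Proof.
move=> on can; have n0 : 0 < n by case: (n) on.
have cna : coprime n a by rewrite coprime_sym.
have nd x : x \in index_iota 1 n./2.+1 -> ~~ (n %| x).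
  by rewrite mem_index_iota => hx; apply/negP => /dvdn_leq; lia.
have inj : {in index_iota 1 n./2.+1 &, injective (fun x => fold_half n (a * x))}.
  move=> x y xI yI E.
  have hx := nd _ xI; have hy := nd _ yI.
  move: xI yI; rewrite !mem_index_iota => xI yI.
  have [H|H] : (a * x = a * y %[mod n]) \/ (n %| a * x + a * y).
    case: (fold_halfP (a * x) n0); case: (fold_halfP (a * y) n0); rewrite E.
    - by move=> -> ->; left.
    - by move=> H1 H2; right; rewrite /dvdn -modnDml -H2 modnDml.
    - by move=> H2 H1; right; rewrite addnC /dvdn -modnDml -H2 modnDml.
    move=> H1 H2; left; apply/eqP.
    have : fold_half n (a * y) + a * x == fold_half n (a * y) + a * y %[mod n].
      by rewrite (eqP H1) (eqP H2).
    by rewrite eqn_modDl.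
  - wlog le : x y xI yI H {E hx hy} / x <= y.
      move=> W; case: (leqP x y) => h; first exact: W.
      by symmetry; apply: W => //; exact: ltnW.
    move/eqP: H; rewrite eq_sym eqn_mod_dvd ?leq_mul //.
    rewrite -mulnBr Gauss_dvdr // => /dvdn_leq h.
    have [//|lt] : y - x = 0 \/ 0 < y - x by lia.
      lia.
    by move/(_ lt): h; lia.
  - move: H; rewrite -mulnDr Gauss_dvdr // => /dvdn_leq; lia.
apply: uniq_perm; first by rewrite map_inj_in_uniq ?iota_uniq.
  exact: iota_uniq.
have us : uniq [seq fold_half n (a * x) | x <- index_iota 1 n./2.+1].
  by rewrite map_inj_in_uniq ?iota_uniq.
have ss : {subset [seq fold_half n (a * x) | x <- index_iota 1 n./2.+1]
            <= index_iota 1 n./2.+1}.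
  move=> _ /mapP[x xI ->]; rewrite mem_index_iota fold_half_range //.
  by rewrite Gauss_dvdr //; exact: nd.
by case: (uniq_min_size us ss); rewrite ?size_map.
Qed.

(* The Gauss sign does not depend on the chosen half-system: two of them differ
   by a function e of x up to sign, and a permutes the classes up to sign. *)
Lemma big_even_xor n a (P e : pred nat) : odd n -> coprime a n ->
  (forall x, ~~ (n %| x) -> P (fold_half n x) = P x) ->
  (forall x, ~~ (n %| x) -> P (a * x) = P x) ->
  (forall x, P x -> ~~ (n %| x) -> e (fold_half n x) = e x) ->
  \big[addb/false]_(1 <= x < n./2.+1 | P x) (e x (+) e (a * x)) = false.
Proof.
move=> on can Pf Pa ef; have cna : coprime n a by rewrite coprime_sym.
have nd x : x \in index_iota 1 n./2.+1 -> ~~ (n %| x).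
  by rewrite mem_index_iota => hx; apply/negP => /dvdn_leq; lia.
rewrite big_split /=.
have -> : \big[addb/false]_(1 <= x < n./2.+1 | P x) e x =
          \big[addb/false]_(1 <= x < n./2.+1 | P x) e (a * x).
  rewrite -[LHS](perm_big _ (perm_fold_half on can)) big_map.
  rewrite big_seq_cond [RHS]big_seq_cond; apply: eq_big => x.
    case xI : (x \in _) => //=.
    by rewrite Pf ?Pa ?Gauss_dvdr //; exact: nd.
  case/andP=> xI; rewrite Pf ?Gauss_dvdr ?nd // => Px.
  by rewrite ef ?Gauss_dvdr ?nd.
by rewrite addbb.
Qed.

Lemma big_xor_period (f : nat -> bool) n k j : (forall x, f (n + x) = f x) ->
  \big[addb/false]_(0 <= x < n) f x = false ->
  \big[addb/false]_(0 <= x < n * k + j) f x = \big[addb/false]_(0 <= x < j) f x.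
Proof.
move=> fn f0; elim: k => [|k IH]; first by rewrite muln0.
rewrite mulnS -addnA (@big_cat_nat _ _ _ n) ?leq_addr //= f0 addFb.
rewrite -{1}[n]add0n big_addn addKn -[RHS]IH.
by apply: eq_bigr => i _; rewrite addnC fn.
Qed.

Lemma half_mul_odd n m : odd n -> odd m -> (n * m)./2 = n * m./2 + n./2.
Proof.
move=> on om; have := odd_double_half m; have := odd_double_half n.
rewrite on om -!muln2 => nE mE.
have -> : n * m = true + (n * m./2 + n./2).*2.
  rewrite -mul2n {1}/nat_of_bool; move: nE mE; rewrite /nat_of_bool.
  by set i := n./2; set j := m./2 => nE mE; nia.
by rewrite half_bit_double.
Qed.

Lemma big_upper_reflect (F : nat -> bool) n : odd n ->
  \big[addb/false]_(n./2.+1 <= x < n) F x =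
  \big[addb/false]_(1 <= x < n./2.+1) F (n - x).
Proof.
move=> on; rewrite big_nat_rev /= -[X in \big[_/_]_(X <= _ < _) _]add1n big_addn.
rewrite (_ : n - n./2 = n./2.+1); last by have := odd_double_half n; lia.
by apply: eq_big_nat => i hi; congr F; lia.
Qed.

(** Pair x with n - x: both [upper] bits flip, so the two terms are equal and cancel. *)
Lemma big_upper_period n a : odd n -> coprime a n ->
  \big[addb/false]_(0 <= x < n) (upper n x (+) upper n (a * x)) = false.
Proof.
move=> on can; have n0 : 0 < n by case: (n) on.
have cna : coprime n a by rewrite coprime_sym.
have D0 : upper n 0 (+) upper n (a * 0) = false by rewrite muln0 addbb.
rewrite (@big_cat_nat _ _ _ n./2.+1) //=; last by lia.
rewrite big_ltn // D0 addFb.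
rewrite big_upper_reflect // -big_split /= big_nat big1 // => i hi.
have nd : ~~ (n %| i) by apply/negP => /dvdn_leq; lia.
have E : i + (n - i) = n by lia.
rewrite (@upper_opp n i (n - i)) ?E // (@upper_opp n (a * i) (a * (n - i))) //.
- by case: (upper n i); case: (upper n (a * i)).
- by rewrite -mulnDr E dvdn_mull.
by rewrite Gauss_dvdr.
Qed.

(* The multiples of n contribute the symbol modulo m; on the other classes
   [upper n] is another half-system for n * m, and the symbol modulo n comes out
   since full periods contribute nothing. *)
Lemma gauss_signM a n m : odd n -> odd m -> coprime a n -> coprime a m ->
  gauss_sign a (n * m) = gauss_sign a n (+) gauss_sign a m.
Proof.
move=> on om can cam.
have n0 : 0 < n by case: (n) on.
have onm : odd (n * m) by rewrite oddM on.
have canm : coprime a (n * m) by rewrite coprimeMr can.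
have cna : coprime n a by rewrite coprime_sym.
have nm0 : 0 < n * m by case: (n * m) onm.
rewrite {1}/gauss_sign (bigID (fun x => n %| x)) /= addbC; congr (_ (+) _).
  transitivity (\big[addb/false]_(1 <= x < (n * m)./2.+1 | ~~ (n %| x))
     (upper n x (+) upper n (a * x))).
    set e := fun x => upper (n * m) x (+) upper n x.
    have E : \big[addb/false]_(1 <= x < (n * m)./2.+1 | ~~ (n %| x))
        (e x (+) e (a * x)) = false.
      apply: big_even_xor => //.
    - by move=> x _; rewrite dvdn_fold_half ?dvdn_mulr.
    - by move=> x _; rewrite Gauss_dvdr.
    - move=> x nx nmx; rewrite /e.
      have nfx : ~~ (n %| fold_half (n * m) x) by rewrite dvdn_fold_half ?dvdn_mulr.
      case: (fold_halfP x nm0) => [H|H].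
        rewrite (upper_eqmod H) (@upper_eqmod n _ x) //.
        by rewrite -(@modn_dvdm (n * m)) ?dvdn_mulr // H modn_dvdm ?dvdn_mulr.
      have H' : n %| fold_half (n * m) x + x by apply: dvdn_trans H; rewrite dvdn_mulr.
      rewrite (@upper_opp _ _ x onm H) ?(@upper_opp n _ x on H') //.
        by rewrite addbN addNb negbK.
      by apply: contra nfx; apply: dvdn_trans; rewrite dvdn_mulr.
    rewrite -[RHS]addFb -[X in _ = X (+) _]E -big_split /=.
    apply: eq_bigr => x _; rewrite /e.
    by case: (upper n x); case: (upper n (a * x));
       case: (upper _ x); case: (upper _ (a * x)).
  rewrite -[RHS]/(gauss_sign a n) /gauss_sign.
  transitivity (\big[addb/false]_(1 <= x < (n * m)./2.+1)
     (upper n x (+) upper n (a * x))).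
    rewrite [RHS](bigID (fun x => n %| x)) /= [X in _ = X (+) _]big1 //.
    by move=> x nx; rewrite !dvdn_upper ?dvdn_mull.
  have D0 : upper n 0 (+) upper n (a * 0) = false by rewrite muln0 addbb.
  have D1 k : \big[addb/false]_(1 <= x < k.+1) (upper n x (+) upper n (a * x)) =
    \big[addb/false]_(0 <= x < k.+1) (upper n x (+) upper n (a * x)).
    by rewrite [RHS]big_ltn // D0.
  rewrite !D1 half_mul_odd // -addnS big_xor_period //.
    move=> x; congr (_ (+) _); apply: upper_eqmod; first by rewrite modnDl.
    by rewrite mulnDr modnMDl.
  exact: big_upper_period.
(* The multiples of n are x = n y with y in the half-system modulo m, and [upper (n * m) (n * y)] is
   [upper m y]. *)
rewrite /gauss_sign -big_filter.
have pE : perm_eq [seq x <- index_iota 1 (n * m)./2.+1 | n %| x]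
                 [seq n * y | y <- index_iota 1 m./2.+1].
  apply: uniq_perm; first by rewrite filter_uniq ?iota_uniq.
    rewrite map_inj_uniq ?iota_uniq // => x y /eqP.
    by rewrite eqn_pmul2l // => /eqP.
  move=> x; rewrite mem_filter mem_index_iota; apply/andP/mapP.
    case=> /dvdnP[q ->] hq; exists q; last by rewrite mulnC.
    move: hq; rewrite mem_index_iota half_mul_odd // => hq.
    by have := odd_double_half n; rewrite on -muln2; nia.
  case=> y; rewrite mem_index_iota => hy ->; rewrite dvdn_mulr //; split=> //.
  rewrite half_mul_odd //; nia.
rewrite (perm_big _ pE) big_map; apply: eq_bigr => y _.
by rewrite /upper mulnCA -!muln_modr mulnCA [2 * (n * _)]mulnCA !ltn_pmul2l.
Qed.

(** The floor of 2 y / n is odd exactly when y modulo n lies in the upper half, and no x of the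
    range does. *)
Lemma gauss_sign_floor a n : odd n ->
  gauss_sign a n = odd (\sum_(1 <= x < n./2.+1) (2 * (a * x)) %/ n).
Proof.
move=> on; have n0 : 0 < n by case: (n) on.
rewrite /gauss_sign (big_morph odd oddD (erefl : odd 0 = false)).
apply: eq_big_nat => x hx.
have -> : upper n x = false by rewrite /upper modn_small; lia.
rewrite addFb /upper; set y := a * x.
have ly := ltn_pmod y n0.
rewrite {2}(divn_eq y n) mulnDr mulnA divnMDl // oddD oddM /=.
have [h|h] := ltnP n (2 * (y %% n)); last by rewrite divn_small //; lia.
by rewrite (_ : 2 * (y %% n) = 1 * n + (2 * (y %% n) - n)) ?divnMDl ?divn_small //; lia.
Qed.

Lemma sum_leq_minn J q : \sum_(1 <= j < J.+1) (j <= q) = minn J q.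
Proof.
elim: J => [|J IH]; first by rewrite big_nil min0n.
by rewrite big_nat_recr //= IH; lia.
Qed.

Lemma divn_sum y n J : 0 < n -> y < n * J.+1 ->
  \sum_(1 <= j < J.+1) (n * j <= y) = y %/ n.
Proof.
move=> n0 hy; transitivity (\sum_(1 <= j < J.+1) (j <= y %/ n)).
  by apply: eq_bigr => j _; rewrite leq_divRL // mulnC.
by rewrite sum_leq_minn; apply/minn_idPr; rewrite -ltnS ltn_divLR // mulnC.
Qed.

(* Eisenstein's count of the lattice points on either side of n j = 2 a x. *)
Lemma lattice_reciprocity a n : 0 < a -> odd n -> coprime a n ->
  \sum_(1 <= x < n./2.+1) (2 * (a * x)) %/ n
  + \sum_(1 <= j < a) (n * j) %/ (2 * a) = n./2 * a.-1.
Proof.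
move=> a0 on can; have n0 : 0 < n by case: (n) on.
have cna : coprime n a by rewrite coprime_sym.
have cn2 : coprime n 2 by rewrite coprime_sym coprime2n.
have nE : n = (n./2).*2.+1 by have := odd_double_half n; rewrite on.
transitivity (\sum_(1 <= x < n./2.+1) \sum_(1 <= j < a)
  ((n * j <= 2 * (a * x)) + (2 * a * x <= n * j))).
  under [RHS]eq_bigr do rewrite big_split /=.
  rewrite big_split /=.
  congr (_ + _).
    apply: eq_big_nat => x hx; rewrite -[a in RHS](prednK a0) divn_sum ?prednK //.
    by move: hx nE; nia.
  rewrite exchange_big /=; apply: eq_big_nat => j hj.
  by rewrite divn_sum ?muln_gt0 //; move: hj nE; nia.
transitivity (\sum_(1 <= x < n./2.+1) \sum_(1 <= j < a) 1).
  apply: eq_big_nat => x hx; apply: eq_bigr => j _.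
  have : n * j != 2 * (a * x).
    apply/negP => /eqP E; have : n %| 2 * (a * x) by rewrite -E dvdn_mulr.
    by rewrite !Gauss_dvdr // => /dvdn_leq; lia.
  by rewrite mulnA; case: ltngtP.
by rewrite !sum_nat_const_nat muln1 mulnC subn1 subSS subn0 mulnC.
Qed.

(** By [lattice_reciprocity] the floor sum has the parity of (n-1)/2 (a - 1) plus the sum over j < a
    of the floors of n j / (2 a). Replacing n by n + 4 a t adds 2 a t to (n-1)/2 and 2 t j to each
    floor, so no parity changes. *)
Lemma gauss_sign_eqmod a n n' : 0 < a -> odd n -> coprime a n ->
  n = n' %[mod 4 * a] -> gauss_sign a n = gauss_sign a n'.
Proof.
move=> a0; wlog le : n n' / n <= n'.
  move=> W on can E; case: (leqP n n') => h; first exact: W.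
  symmetry; apply: W; rewrite ?(ltnW h) //.
    by rewrite -(@odd_mod n' (4 * a)) ?oddM // -E odd_mod ?oddM.
  by rewrite -coprime_modr -(@modn_dvdm (4 * a)) ?dvdn_mull // -E
    modn_dvdm ?dvdn_mull // coprime_modr.
move=> on can /eqP; rewrite eq_sym eqn_mod_dvd // => /dvdnP[t tE].
have {tE}n'E : n' = n + 4 * a * t by rewrite mulnC -tE subnKC.
have on' : odd n' by rewrite n'E oddD !oddM on.
have can' : coprime a n'.
  by rewrite -coprime_modr n'E -mulnA mulnCA -modnDmr modnMr addn0 coprime_modr.
rewrite !gauss_sign_floor //.
have := lattice_reciprocity a0 on can; have := lattice_reciprocity a0 on' can'.
have -> : n'./2 = n./2 + 2 * (a * t).
  have : n'.*2 = n.*2 + 8 * (a * t) by rewrite n'E; lia.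
  have := odd_double_half n; have := odd_double_half n'; rewrite on on'; lia.
have -> : \sum_(1 <= j < a) (n' * j) %/ (2 * a) =
  \sum_(1 <= j < a) (n * j) %/ (2 * a) + 2 * \sum_(1 <= j < a) t * j.
  rewrite big_distrr /= -big_split /=; apply: eq_bigr => j _.
  rewrite n'E (_ : (n + 4 * a * t) * j = 2 * (t * j) * (2 * a) + n * j); last by nia.
  by rewrite divnMDl ?muln_gt0 // addnC.
move=> /(congr1 odd) + /(congr1 odd).
rewrite !(oddD, oddM, andFb, addFb, addbF) /= ?addbF => <- H.
by move: H; case: (odd (\sum_(1 <= j < a) _)); rewrite ?addbT ?addbF => // /negb_inj.
Qed.

(** The extension to negative a uses the supplementary law (-1/n) = (-1)^((n-1)/2); for odd n,
    (n-1)/2 is [n./2]. *)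
Definition jacobi_sign (a : int) (n : nat) : bool :=
  gauss_sign `|a| n (+) ((a < 0)%R && odd n./2).

Lemma jacobi_signM a n m : odd n -> odd m -> coprime `|a| n -> coprime `|a| m ->
  jacobi_sign a (n * m) = jacobi_sign a n (+) jacobi_sign a m.
Proof.
move=> on om can cam; rewrite /jacobi_sign gauss_signM // half_mul_odd //.
rewrite oddD oddM on /=; case: (gauss_sign _ n); case: (gauss_sign _ m);
by case: (a < 0)%R; case: (odd n./2); case: (odd m./2).
Qed.

Lemma jacobi_sign1 a : jacobi_sign a 1 = false.
Proof. by rewrite /jacobi_sign andbF /gauss_sign big_nil. Qed.

Lemma jacobi_sign_eqmod a n n' : a != 0%R -> odd n -> coprime `|a| n ->
  n = n' %[mod 4 * `|a|] -> jacobi_sign a n = jacobi_sign a n'.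
Proof.
move=> a0 on can E; rewrite /jacobi_sign (gauss_sign_eqmod _ on can E); last by lia.
congr (_ (+) (_ && _)).
have : n = n' %[mod 4].
  by rewrite -(@modn_dvdm (4 * `|a|)) ?dvdn_mulr // E modn_dvdm ?dvdn_mulr.
by move=> ?; lia.
Qed.

Local Open Scope ring_scope.

(** * Gauss's lemma and Euler's criterion modulo a prime *)

Lemma Fp_natr_eq0 p (n : nat) : prime p -> (n%:R == 0 :> 'F_p) = (p %| n)%N.
Proof. by move=> pp; rewrite (dvdn_pcharf (pchar_Fp pp)). Qed.

Lemma Fp_natr_eq p (m n : nat) : prime p -> m = n %[mod p] -> m%:R = n%:R :> 'F_p.
Proof. by move=> pp E; rewrite -[LHS](Fp_nat_mod pp) E Fp_nat_mod. Qed.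

Lemma Fp_intr_eq0 p (a : int) : prime p -> (a%:~R == 0 :> 'F_p) = (p %| `|a|)%N.
Proof.
by move=> pp; case: (intP a) => [|n|n];
  rewrite ?rmorphN ?oppr_eq0 ?abszN -?pmulrn ?Fp_natr_eq0.
Qed.

(** The product of all a x over the half-system is computed twice: by pulling out the powers of a,
    and by folding each factor back to the half-system at the cost of a sign. *)
Lemma gauss_lemma p (a : nat) : prime p -> odd p -> coprime a p ->
  (a%:R : 'F_p) ^+ p./2 = (-1) ^+ gauss_sign a p.
Proof.
move=> pp op cap; have p0 := prime_gt0 pp.
set P : 'F_p := \prod_(1 <= x < p./2.+1) x%:R.
have P0 : P != 0.
  rewrite /P big_seq prodf_seq_neq0; apply/allP => x.
  rewrite mem_index_iota => hx. apply/implyP => _.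
  by rewrite Fp_natr_eq0 //; apply/negP => /dvdn_leq; lia.
have E1 : \prod_(1 <= x < p./2.+1) (a * x)%N%:R = a%:R ^+ p./2 * P :> 'F_p.
  under eq_bigr do rewrite natrM.
  by rewrite big_split /= prodr_const_nat subn1.
have E2 : \prod_(1 <= x < p./2.+1) (a * x)%N%:R = (-1) ^+ gauss_sign a p * P :> 'F_p.
  rewrite /P -[\prod_(1 <= x < _) x%:R](perm_big _ (perm_fold_half op cap)) big_map.
  rewrite /gauss_sign (big_morph (fun b : bool => (-1 : 'F_p) ^+ b) (@signr_addb _) (erefl _)).
  rewrite -big_split /=; apply: eq_big_nat => x hx.
  have -> : upper p x = false by rewrite /upper modn_small; lia.
  rewrite addFb /fold_half; case: ifP => _ /=; last first.
    by rewrite mul1r; apply: Fp_natr_eq; rewrite ?modn_mod.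
  rewrite natrB ?(ltnW (ltn_pmod _ _)) // pchar_Fp_0 // sub0r mulN1r opprK.
  by apply: Fp_natr_eq; rewrite ?modn_mod.
by apply: (mulIf P0); rewrite -E1 -E2.
Qed.

Lemma jacobi_sign_exp p (a : int) : prime p -> odd p -> ~~ (p %| `|a|)%N ->
  (a%:~R : 'F_p) ^+ p./2 = (-1) ^+ jacobi_sign a p.
Proof.
move=> pp op da; have cap : coprime `|a| p by rewrite coprime_sym prime_coprime.
rewrite /jacobi_sign signr_addb -(gauss_lemma pp op cap).
rewrite {1}(intEsign a) intrM exprMn mulrC -pmulrn; congr (_ * _).
by rewrite rmorph_sign; case: (a < 0) => /=; rewrite ?expr1 ?signr_odd // expr0 expr1n.
Qed.

Lemma Fp_prim_root p : prime p -> exists g : 'F_p, p.-1.-primitive_root g.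
Proof.
move=> pp; have p1 := prime_gt1 pp.
set rs := [seq x <- enum 'F_p | x != 0].
have : has p.-1.-primitive_root rs.
  apply: has_prim_root; first by lia.
  - apply/allP => x; rewrite mem_filter => /andP[x0 _].
    apply/unity_rootP/(mulfI x0); rewrite mulr1 -exprS prednK ?prime_gt0 //.
    by have := expf_card x; rewrite card_Fp.
  - by rewrite filter_uniq ?enum_uniq.
  have /card_uniqP <- : uniq rs by rewrite filter_uniq ?enum_uniq.
  rewrite (eq_card (B := predC1 (0 : 'F_p))) ?cardC1 ?card_Fp //.
  by move=> x; rewrite mem_filter mem_enum andbT.
by case/hasP=> g _ gp; exists g.
Qed.

Lemma prim_root_Fp p (g r : 'F_p) : prime p -> p.-1.-primitive_root g -> r != 0 ->
  exists i, r = g ^+ i.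
Proof.
move=> pp gp r0.
have : r ^+ p.-1 = 1.
  apply/(mulfI r0); rewrite mulr1 -exprS prednK ?prime_gt0 //.
  by have := expf_card r; rewrite card_Fp.
by case/(prim_rootP gp) => i ->; exists i.
Qed.

Lemma euler_criterion p (r : 'F_p) : prime p -> odd p -> r != 0 ->
  (r ^+ p./2 == 1) = [exists y : 'F_p, y ^+ 2 == r].
Proof.
move=> pp op r0; have [g gp] := Fp_prim_root pp.
have p1 := prime_gt1 pp.
have pE : p.-1 = (p./2 * 2)%N by have := odd_double_half p; rewrite op; lia.
apply/eqP/existsP => [|[y /eqP yr]].
  have [i ->] := prim_root_Fp pp gp r0.
  rewrite -exprM => /eqP; rewrite -(prim_order_dvd gp) pE mulnC dvdn_pmul2r; last by lia.
  by case/dvdnP=> k ->; exists (g ^+ k); rewrite exprM.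
have y0 : y != 0 by apply: contraNneq r0 => y0; rewrite -yr y0 expr0n.
rewrite -yr -exprM mulnC -pE; apply/(mulfI y0); rewrite mulr1 -exprS prednK ?prime_gt0 //.
by have := expf_card y; rewrite card_Fp.
Qed.

Lemma jacobi_sign_prime p (a : int) : prime p -> odd p -> ~~ (p %| `|a|)%N ->
  jacobi_sign a p = ~~ [exists y : 'F_p, y ^+ 2 == a%:~R].
Proof.
move=> pp op da; rewrite -euler_criterion ?Fp_intr_eq0 // jacobi_sign_exp //.
case: (jacobi_sign a p); rewrite ?eqxx // expr1 eq_sym -subr_eq0 opprK.
rewrite -[1 + 1]/(2%:R) Fp_natr_eq0 //.
by apply/esym/negP => /dvdn_leq; have := prime_gt1 pp; lia.
Qed.

(** * Producing new primes from one non-Wieferich prime *)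

Local Open Scope nat_scope.

Lemma expn_1D_expand y m :
  exists z, (1 + y) ^ m = 1 + m * y + 'C(m, 2) * y ^ 2 + y ^ 3 * z.
Proof.
elim: m => [|m [z zE]]; first by exists 0; rewrite bin0n; lia.
exists ('C(m, 2) + z + y * z); rewrite expnS zE binS bin1.
by rewrite !expnS !expn0; ring.
Qed.

(** The linear term is p^(e+1) u. The quadratic one is divisible by p^(2e+1), as odd p divides C(p,
    2), and the rest by p^(3e); both exponents are at least e + 2. *)
Lemma lte_step p e u : prime p -> odd p -> 0 < e -> ~~ (p %| u) ->
  exists2 u', ~~ (p %| u') & (1 + p ^ e * u) ^ p = 1 + p ^ e.+1 * u'.
Proof.
move=> pp op e0 pu; have [z ->] := expn_1D_expand (p ^ e * u) p.
have p3 : 2 < p by have := prime_gt1 pp; case: (p) op => [|[|[|]]].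
have /dvdnP[c ->] : p %| 'C(p, 2) by apply: prime_dvd_bin.
have [e' ->] : exists e', e = e'.+1 by exists e.-1; lia.
exists (u + p * (c * p ^ e' * u ^ 2 + p ^ e' * p ^ e' * u ^ 3 * z)).
  by rewrite dvdn_addl ?(@dvdn_mulr p p).
by rewrite !expnS !expn0; ring.
Qed.

Lemma lte_coprime p e u m : prime p -> 0 < e -> ~~ (p %| u) -> ~~ (p %| m) ->
  exists2 u', ~~ (p %| u') & (1 + p ^ e * u) ^ m = 1 + p ^ e * u'.
Proof.
move=> pp e0 pu pm; have [z ->] := expn_1D_expand (p ^ e * u) m.
have [e' ->] : exists e', e = e'.+1 by exists e.-1; lia.
exists (m * u + p * ('C(m, 2) * p ^ e' * u ^ 2 + p ^ e' * p ^ e' * p * u ^ 3 * z)).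
  by rewrite dvdn_addl ?(@dvdn_mulr p p) // Euclid_dvdM // negb_or pm.
by rewrite !expnS !expn0; ring.
Qed.

(** Write m = m' p^v with m' prime to p: the power m' keeps the valuation and each further p-th
    power raises it by one. *)
Lemma lte_exp p u m : prime p -> odd p -> ~~ (p %| u) -> 0 < m ->
  exists2 u', ~~ (p %| u') & (1 + p * u) ^ m = 1 + p ^ (logn p m).+1 * u'.
Proof.
move=> pp op pu m0; have [m' pm' ->] := pfactor_coprime pp m0.
have pm : ~~ (p %| m') by rewrite -prime_coprime.
have m'0 : 0 < m' by case: (m') pm => //; rewrite dvdn0.
have -> : logn p (m' * p ^ logn p m) = logn p m.
  have ppos : 0 < p ^ logn p m by rewrite expn_gt0 prime_gt0.
  by rewrite lognM // pfactorK // logn_coprime.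
rewrite expnM; have [u1 pu1 ->] := lte_coprime pp (erefl : 0 < 1) pu pm.
elim: (logn p m) => [|i [u2 pu2 IH]]; first by exists u1.
by rewrite [p ^ i.+1]expnSr expnM IH; apply: lte_step.
Qed.

(* Pigeonhole: dividing the values at s < p ^ j by p gives distinct residues
   modulo p ^ j, so one of them is 0. *)
Lemma hensel_exp p u c F j : prime p -> odd p -> ~~ (p %| u) -> ~~ (p %| c) ->
  p %| F -> exists s, p ^ j.+1 %| F + c * ((1 + p * u) ^ s - 1).
Proof.
move=> pp op pu pc /dvdnP[F' ->].
set G := fun s => F' * p + c * ((1 + p * u) ^ s - 1).
have pj0 : 0 < p ^ j by rewrite expn_gt0 prime_gt0.
have GE s : exists d, G s = p * d.
  case: s => [|s]; first by exists F'; rewrite /G expn0 subnn muln0 addn0 mulnC.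
  have [u' _ E] := lte_exp pp op pu (ltn0Sn s).
  exists (F' + c * (p ^ logn p s.+1 * u')).
  by rewrite /G E addKn expnS mulnDr mulnC; congr (_ + _); ring.
pose d (s : 'I_(p ^ j)) : 'I_(p ^ j) := Ordinal (ltn_pmod (G s %/ p) pj0).
have dinj : injective d.
  move=> s s' /(congr1 val) /= /eqP; apply: contraTeq.
  wlog lt : s s' / s < s'.
    move=> W neq; have := neq; rewrite -val_eqE neq_ltn => /orP[h|h]; first exact: W.
    by rewrite eq_sym; apply: W; rewrite // eq_sym.
  move=> _.
  have [ds dsE] := GE s; have [ds' ds'E] := GE s'.
  rewrite dsE ds'E !mulKn ?prime_gt0 //; apply/negP.
  have ss0 : 0 < s' - s by lia.
  have [u' pu' E] := lte_exp pp op pu ss0.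
  (* By [lte_exp] the difference G s' - G s has valuation exactly one more than s' - s; equal
     residues would thus make p^j divide s' - s < p^j. *)
  have GG : G s' = G s + c * (1 + p * u) ^ s * (p ^ (logn p (s' - s)).+1 * u').
    have -> : (p ^ (logn p (s' - s)).+1 * u') = (1 + p * u) ^ (s' - s) - 1.
      by rewrite E addKn.
    rewrite /G -{1}(subnKC (ltnW lt)) expnD.
    have : 0 < (1 + p * u) ^ s by rewrite expn_gt0 addn_gt0.
    have : 0 < (1 + p * u) ^ (s' - s) by rewrite expn_gt0 addn_gt0.
    case: (_ ^ (s' - s)) => // B _; case: (_ ^ s) => // A _.
    by rewrite mulSn addSn !subn1 /=; ring.
  have lds : ds <= ds'.
    by rewrite -(leq_pmul2l (prime_gt0 pp)) -dsE -ds'E GG leq_addr.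
  rewrite eq_sym eqn_mod_dvd //.
  have -> : ds' - ds = c * (1 + p * u) ^ s * (p ^ (logn p (s' - s)) * u').
    apply/eqP; rewrite -(eqn_pmul2l (prime_gt0 pp)) mulnBr -dsE -ds'E GG addKn.
    by apply/eqP; rewrite expnS; ring.
  have cp z : ~~ (p %| z) -> coprime (p ^ j) z.
    by move=> h; rewrite coprimeXl // prime_coprime.
  rewrite Gauss_dvdr; last first.
    apply: cp; rewrite Euclid_dvdM // negb_or pc Euclid_dvdX // negb_and.
    by rewrite dvdn_addl ?(@dvdn_mulr p p) // dvdn1 neq_ltn prime_gt1 // orbT.
  rewrite Gauss_dvdl; last exact: cp.
  rewrite dvdn_Pexp2l ?prime_gt1 // -pfactor_dvdn //.
  move/(dvdn_leq ss0); rewrite leqNgt => /negP; apply.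
  exact: leq_ltn_trans (leq_subr _ _) (ltn_ord s').
have /codomP[s sE] := injF_onto dinj (Ordinal pj0).
exists s; have [ds dsE] := GE s; move/(congr1 val): sE => /=.
rewrite dsE mulKn ?prime_gt0 // => /esym/eqP h.
by rewrite -/(G s) dsE expnS dvdn_pmul2l ?prime_gt0.
Qed.

(** Each W-th power of 1 + W^(n+1) s gains a factor W: in the linear term by the exponent, in the
    others by the square of W^(n+1). *)
Lemma expn_mod1_pow g f W n : 0 < g -> g ^ f = 1 %[mod W] ->
  W ^ n.+1 %| g ^ (f * W ^ n) - 1.
Proof.
move=> g0 /eqP gE.
suff [s ->] : exists s, g ^ (f * W ^ n) = 1 + W ^ n.+1 * s by rewrite addKn dvdn_mulr.
elim: n => [|n [s IH]].
  move: gE; rewrite eqn_mod_dvd ?expn_gt0 ?g0 // => /dvdnP[s sE].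
  by exists s; rewrite muln1 expn1 mulnC -sE subnKC ?expn_gt0 ?g0.
rewrite expnSr mulnA expnM IH.
have [z ->] := expn_1D_expand (W ^ n.+1 * s) W.
exists (s + 'C(W, 2) * W ^ n * s ^ 2 + W ^ n * W ^ n * W * s ^ 3 * z).
by rewrite !expnS !expn0; ring.
Qed.

Lemma jacobi_sign_logn a p n : prime p -> odd n -> coprime `|a| n ->
  (forall q, prime q -> q %| n -> q != p -> jacobi_sign a q = false) ->
  jacobi_sign a n = odd (logn p n) && jacobi_sign a p.
Proof.
move=> pp; elim/ltn_ind: n => n IH on can nq.
have n0 : 0 < n by case: (n) on.
have [n1|n1] : n = 1 \/ 1 < n by lia.
  by rewrite n1 jacobi_sign1 logn1.
have qp := pdiv_prime n1; have /dvdnP[m mE] := pdiv_dvd n.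
set q := pdiv n in qp mE *.
move: on can; rewrite mE oddM coprimeMr => /andP[om oq] /andP[cam caq].
have m0 : 0 < m by case: (m) om.
rewrite jacobi_signM // IH //; last 2 first.
- by rewrite mE ltn_Pmulr // prime_gt1.
- by move=> r rp rm; apply: nq; rewrite // mE dvdn_mulr.
rewrite lognM ?(prime_gt0 qp) // (logn_prime p qp) oddD.
case: (eqVneq p q) => [->|qnp]; rewrite /= ?addbF.
  by case: (odd _); case: (jacobi_sign a q).
by rewrite (nq q) ?addbF // ?mE ?dvdn_mull // eq_sym.
Qed.

(** The integral counterpart of [special_prime]: with k a natural number, the power minus b is an
    integer. *)
Definition witness (a b : int) (p : nat) : Prop :=
  [/\ prime p, odd p, ~~ (p %| `|a|) && ~~ (p %| `|b|), jacobi_sign a p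
    & exists k : nat, p %| `|(a ^+ (2 * k) - b)%R|].

Lemma logn_eq p e c : prime p -> ~~ (p %| c) -> logn p (p ^ e * c) = e.
Proof.
move=> pp pc; have c0 : 0 < c by case: (c) pc => //; rewrite dvdn0.
by rewrite lognM ?expn_gt0 ?(prime_gt0 pp) // pfactorK // logn_coprime ?prime_coprime // addn0.
Qed.

(** The exponent of q in F is below e and that in E is at least e, so the gcd takes the whole q-part
    of F. *)
Lemma ndvdn_div_gcd F E q e : prime q -> 0 < F -> 0 < E -> ~~ (q ^ e %| F) ->
  q ^ e %| E -> ~~ (q %| F %/ gcdn F E).
Proof.
move=> qp F0 E0 qF qE; have D0 : 0 < gcdn F E by rewrite gcdn_gt0 F0.
have n0 : 0 < F %/ gcdn F E by rewrite divn_gt0 // dvdn_leq // dvdn_gcdl.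
rewrite -[q]expn1 pfactor_dvdn // logn_div ?dvdn_gcdl // logn_gcd //.
by move: qF qE; rewrite !pfactor_dvdn //; lia.
Qed.

(** For k at least |b|, a^(2k) exceeds |b|, so the absolute value is a plain difference and the
    argument can proceed in natural numbers. *)
Lemma shifted_power a b k : `|b| <= k -> 1 < `|a| ->
  0 < `|(a ^+ (2 * k) - b)%R| /\
  (`|(a ^+ (2 * k) - b)%R|%:Z = ((`|a| ^ 2) ^ k)%:Z - b)%R.
Proof.
move=> bk a1.
have -> : (a ^+ (2 * k))%R = ((`|a| ^ 2) ^ k)%:Z%R.
  rewrite exprM -(real_normK (num_real a)) -abszE.
  by rewrite -[in RHS]natz natrX natrX natz.
have : k < (`|a| ^ 2) ^ k by apply: ltn_expl; nia.
lia.
Qed.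

Lemma shifted_power_add a b k j : `|b| <= k -> 1 < `|a| ->
  `|(a ^+ (2 * (k + j)) - b)%R| =
  `|(a ^+ (2 * k) - b)%R| + (`|a| ^ 2) ^ k * ((`|a| ^ 2) ^ j - 1).
Proof.
move=> bk a1; have [_ E1] := shifted_power bk a1.
have [_ E2] := @shifted_power a b (k + j) (leq_trans bk (leq_addr _ _)) a1.
apply/eqP; rewrite -eqz_nat E2 PoszD E1 expnD.
have : 0 < (`|a| ^ 2) ^ j by rewrite !expn_gt0; lia.
move: ((_ ^ 2) ^ j) ((_ ^ 2) ^ k) => y x y0; apply/eqP.
rewrite mulnBr muln1; have : x <= x * y by rewrite leq_pmulr.
by move: (x * y) => z; lia.
Qed.

Theorem witness_unbounded a b p : 1 < `|a| -> b != 0%R -> witness a b p ->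
  ~~ (p ^ 2 %| `|a| ^ p.-1 - 1) -> forall B, exists2 q, B < q & witness a b q.
Proof.
move=> a1 b0 [pp op /andP[pa pb] jp [k1 k1P]] nW B.
apply: contrapT => nex.
have wB q : witness a b q -> q <= B.
  by move=> wq; rewrite leqNgt; apply/negP => Bq; apply: nex; exists q.
have p0 := prime_gt0 pp; have p1 := prime_gt1 pp.
have a0 := ltnW a1.
have ab0 : 0 < `|b| by rewrite absz_gt0.
(* The bound B + 3 lets 2 in whatever B is, so that W |a| is even. *)
set P := [seq q <- iota 0 B.+3 | [&& prime q, q != p & ~~ (q %| `|a|)]].
set W := \prod_(q <- P) q.
have W0 : 0 < W.
  rewrite /W big_seq prodn_cond_gt0 // => q.
  by rewrite mem_filter => /andP[/and3P[/prime_gt0]].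
have Wa : coprime W `|a|.
  rewrite /W big_seq; apply: (big_ind (fun x => coprime x `|a|)) => [|x y|q].
  - exact: coprime1n.
  - by rewrite coprimeMl => ->.
  by rewrite mem_filter => /andP[/and3P[qp _ qa] _]; rewrite prime_coprime.
have Wp : ~~ (p %| W).
  rewrite Euclid_dvd_prod // big_has -all_predC; apply/allP => q.
  rewrite mem_filter => /andP[/and3P[qp qnp _] _] /=.
  by rewrite dvdn_prime2 // eq_sym.
have inW q : prime q -> q != p -> q < B.+3 -> q %| W * `|a|.
  move=> qp qnp qB; case: (boolP (q %| `|a|)) => qa; first by rewrite dvdn_mull.
  rewrite dvdn_mulr // /W (big_rem q) ?dvdn_mulr //=.
  by rewrite mem_filter qp qnp qa mem_iota.
set g := `|a| ^ 2; have g0 : 0 < g by rewrite expn_gt0 a0.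
have cWg : coprime g W by rewrite coprime_sym coprimeXr.
have pg k : ~~ (p %| g ^ k) by rewrite !Euclid_dvdX // !negb_and pa.
(* If |a|^(p-1) = 1 + p t, then u = 2 t + p t^2. The non-Wieferich hypothesis says that p does not
   divide t, and p is odd. *)
have [u pu gE] : exists2 u, ~~ (p %| u) & g ^ p.-1 = 1 + p * u.
  have e1 : 0 < `|a| ^ p.-1 by rewrite expn_gt0 a0.
  have /dvdnP[t tE] : p %| `|a| ^ p.-1 - 1.
    rewrite -eqn_mod_dvd // -(totient_prime pp) Euler_exp_totient //.
    by rewrite coprime_sym prime_coprime.
  exists (2 * t + p * t ^ 2).
    rewrite dvdn_addl ?(@dvdn_mulr p p) // Euclid_dvdM // negb_or.
    apply/andP; split.
      by apply/negP => /dvdn_leq; case: (p) op p1 => [|[|[|]]] //= n _ _ /(_ isT).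
    by move: nW; rewrite tE expnS expn1 dvdn_pmul2r.
  rewrite /g -expnM mulnC expnM (_ : `|a| ^ p.-1 = 1 + p * t); first by ring.
  by rewrite mulnC -tE subnKC.
set e := logn p (totient W).
(* Adding a multiple of p - 1 keeps the divisibility by p. The 3 provides the extra factor |a|^3 in
   the final congruence. *)
set k0 := k1 + p.-1 * (`|b| + 3).
have bk0 : `|b| + 3 <= k0.
  by rewrite /k0 (leq_trans _ (leq_addl _ _)) // leq_pmull // -ltnS prednK.
have pF0 : p %| `|(a ^+ (2 * k0) - b)%R|.
  have : (p%:Z %| (a ^+ (2 * k0) - b)%R)%Z.
    rewrite (_ : (_ - b = (a ^+ (2 * k1) - b) +
      a ^+ (2 * k1) * ((a ^+ (2 * (p.-1 * (`|b| + 3)))) - 1))%R); last first.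
      by rewrite /k0 mulnDr exprD; ring.
    rewrite rpredD ?dvdz_mull //.
    rewrite exprM -(real_normK (num_real a)) -abszE.
    have -> : ((`|a|%N%:Z ^+ 2) ^+ (p.-1 * (`|b| + 3)) - 1 =
        (g ^ (p.-1 * (`|b|%N + 3)) - 1)%N%:Z)%R.
      have E j : ((`|a|%N%:Z ^+ 2) ^+ j = (g ^ j)%N%:Z)%R.
        by rewrite -[in RHS]natz !natrX natz.
      by rewrite E -subzn ?expn_gt0 ?a0.
    rewrite expnM gE; have [z ->] := expn_1D_expand (p * u) (`|b| + 3).
    rewrite -!addnA addKn -[(_ %| _)%Z]/(p %| _).
    rewrite !dvdn_add //; first by rewrite mulnCA dvdn_mulr.
      by rewrite dvdn_mull // expnS -mulnA dvdn_mulr.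
    by rewrite dvdn_mulr // expnS -mulnA dvdn_mulr.
  by [].
(* Now p^(e+3) divides the value at k, so increments of valuation e + 1 and e + 2 will decide the
   valuation. *)
have [s sP] := hensel_exp e.+2 pp op pu (pg k0) pF0.
have bk0' : `|b| <= k0 := leq_trans (leq_addr _ _) bk0.
move: sP; rewrite -gE -expnM -(shifted_power_add _ bk0' a1).
set k := k0 + _ => kP.
have bk : `|b| <= k by rewrite (leq_trans bk0') ?leq_addr.
have [m0 mE] := shifted_power bk a1.
set m := `|_| in m0 mE kP.
(* This makes g^L = 1 modulo W^(m+2). Since q^m > m, the factor W^m already fixes the q-part of the
   value for each prime q dividing W; W^2 is left over for the final congruence. *)
set L := totient W * W ^ m.+1.
have L0 : 0 < L by rewrite muln_gt0 totient_gt0 W0 expn_gt0 W0.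
have LE : logn p L = e.
  by rewrite /L mulnC logn_Gauss // coprimeXr // prime_coprime.
have WL : W ^ m.+2 %| g ^ L - 1.
  by apply: expn_mod1_pow => //; exact: Euler_exp_totient.
(* The exponents k + (p - 1) L and k + (p - 1) p L give the p-adic valuations
   e + 1 and e + 2, and congruent values modulo a high power of W * |a|. *)
have pLE : logn p (p * L) = e.+1 by rewrite lognM // (logn_prime p pp) eqxx LE.
have [u1 pu1] := lte_exp pp op pu L0; rewrite LE => E1.
have pL0 : 0 < p * L by rewrite muln_gt0 p0.
have [u2 pu2] := lte_exp pp op pu pL0; rewrite pLE => E2.
pose G j := `|(a ^+ (2 * (k + p.-1 * j)) - b)%R|.
have GE j : G j = m + g ^ k * (g ^ (p.-1 * j) - 1) by exact: shifted_power_add.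
have bkj j : `|b| <= k + p.-1 * j := leq_trans bk (leq_addr _ _).
have Gb j : Posz (G j) = (((g ^ (k + p.-1 * j))%N)%:Z - b)%R.
  by have [] := shifted_power (bkj j) a1.
have G0 j : 0 < G j by have [] := shifted_power (bkj j) a1.
have /dvdnP[c cE] := kP.
have v1 : logn p (G L) = e.+1.
  rewrite GE expnM gE E1 addKn cE.
  rewrite (_ : _ + _ = p ^ e.+1 * (g ^ k * u1 + p * (c * p))).
    by apply: logn_eq; rewrite // dvdn_addl ?(@dvdn_mulr p p) // Euclid_dvdM // negb_or pg.
  by rewrite !expnS; ring.
have v2 : logn p (G (p * L)) = e.+2.
  rewrite GE expnM gE E2 addKn cE.
  rewrite (_ : _ + _ = p ^ e.+2 * (g ^ k * u2 + p * c)).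
    by apply: logn_eq; rewrite // dvdn_addl ?(@dvdn_mulr p p) // Euclid_dvdM // negb_or pg.
  by rewrite !expnS; ring.
(* E outweighs G j at each unwanted prime q: q^m does not divide G j if q divides W, nor does q^|b|
   if q divides a, as it would then divide b. Dividing G j by its gcd with E removes these
   primes. *)
set E := W ^ m * `|a| ^ `|b|.
have E0 : 0 < E by rewrite muln_gt0 !expn_gt0 W0 a0.
have Ep : ~~ (p %| E).
  by rewrite Euclid_dvdM // negb_or !Euclid_dvdX // !negb_and Wp pa.
have copr j q : W ^ m.+2 %| g ^ (p.-1 * j) - 1 -> prime q -> q %| W * `|a| ->
    ~~ (q %| G j %/ gcdn (G j) E).
  move=> Wj qp; rewrite Euclid_dvdM // => /orP[qW|qa].
    apply: (@ndvdn_div_gcd _ _ q m) => //; last by rewrite dvdn_mulr // dvdn_exp2r.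
    apply/negP; rewrite GE dvdn_addl; last first.
      rewrite dvdn_mull // (dvdn_trans _ Wj) //.
      by rewrite (dvdn_trans (dvdn_exp2r m qW)) // dvdn_exp2l // -addn2 leq_addr.
    by move/(dvdn_leq m0); rewrite leqNgt ltn_expl // prime_gt1.
  apply: (@ndvdn_div_gcd _ _ q `|b|) => //; last by rewrite dvdn_mull // dvdn_exp2r.
  apply/negP => qG.
  have : ((q ^ `|b|)%N%:Z %| b)%Z.
    rewrite [X in (_ %| X)%Z](_ : b = (g ^ (k + p.-1 * j))%N%:Z - (G j)%:Z)%R; last first.
      by rewrite Gb opprD opprK addrA subrr add0r.
    rewrite rpredB //; rewrite -[(_ %| _)%Z]/(q ^ `|b| %| g ^ (k + p.-1 * j)).
    rewrite (dvdn_trans (dvdn_exp2l q (bkj j))) // dvdn_exp2r //.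
    by rewrite dvdn_exp.
  by move/(dvdn_leq ab0); rewrite leqNgt ltn_expl // prime_gt1.
have two : 2 %| W * `|a|.
  by apply: inW => //; apply: contraL op => /eqP <-.
pose n j := G j %/ gcdn (G j) E.
have nlog j : logn p (n j) = logn p (G j).
  rewrite logn_div ?dvdn_gcdl // logn_gcd // (@logn_coprime p E) ?prime_coprime //.
  by rewrite minn0 subn0.
(* A prime factor q of n j other than p exceeds B and divides G j; with [jacobi_sign a q] true it
   would be a witness. So only p contributes to the symbol. *)
have jac j : W ^ m.+2 %| g ^ (p.-1 * j) - 1 ->
    [/\ odd (n j), coprime `|a| (n j) &
    jacobi_sign a (n j) = odd (logn p (G j))].
  move=> Wj; have on : odd (n j) by have := copr j 2 Wj isT two; rewrite dvdn2 negbK.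
  have can : coprime `|a| (n j).
    have gn0 : 0 < gcdn `|a| (n j) by rewrite gcdn_gt0 a0.
    rewrite /coprime eqn_leq gn0 andbT leqNgt; apply/negP => gn1.
    have := copr j _ Wj (pdiv_prime gn1).
    have := pdiv_dvd (gcdn `|a| (n j)); rewrite dvdn_gcd => /andP[da dn].
    by rewrite dvdn_mull // => /(_ isT); rewrite dn.
  split=> //; rewrite (@jacobi_sign_logn a p) // ?jp ?andbT ?nlog //.
  move=> q qp qn qnp; apply/negbTE/negP => jq.
  have qWa : ~~ (q %| W * `|a|) by apply/negP => /(copr j _ Wj qp); rewrite qn.
  have qB : B.+3 <= q.
    by rewrite leqNgt; apply/negP => /(inW q qp qnp); rewrite (negbTE qWa).
  have qa : ~~ (q %| `|a|) by apply: contra qWa => ?; rewrite dvdn_mull.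
  have qG : q %| G j by apply: dvdn_trans qn _; rewrite dvdn_div ?dvdn_gcdl.
  have : q <= B.
    apply: wB; split=> //; last by exists (k + p.-1 * j).
      case: (even_prime qp) => // q2; by rewrite q2 in qB.
    rewrite qa /=; apply: contra qa => qb.
    have : (q%:Z %| Posz (g ^ (k + p.-1 * j)))%Z.
      by rewrite (_ : Posz (g ^ _) = (G j)%:Z + b)%R; [exact: rpredD|rewrite Gb subrK].
    rewrite -[(_ %| _)%Z]/(q %| g ^ (k + p.-1 * j)).
    by rewrite !Euclid_dvdX // => /andP[/andP[]].
  by rewrite leqNgt (leq_trans _ qB) // ltnW.
have Wi i : W ^ m.+2 %| g ^ (i * L) - 1.
  rewrite -eqn_mod_dvd ?expn_gt0 ?a0 // mulnC expnM -modnXm.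
  move: WL; rewrite -eqn_mod_dvd ?expn_gt0 ?a0 // => /eqP ->.
  by rewrite modnXm exp1n.
have WpL : W ^ m.+2 %| g ^ (p.-1 * (p * L)) - 1 by rewrite mulnA.
have [on1 can1 j1] := jac L (Wi p.-1).
have [on2 can2 j2] := jac (p * L) WpL.
(* The values differ by a multiple of W^(m+2) |a|^(|b|+3). Hence their gcds with E agree, and the
   quotients differ by a multiple of W^2 |a|^3, thus of 4 |a| because W |a| is even. *)
have [z zE] : exists z, G (p * L) = G L + E * (W ^ 2 * `|a| ^ 3 * z).
  have /dvdnP[x xE] := Wi (p.-1 * p.-1).
  have /dvdnP[y yE] : `|a| ^ (`|b| + 3) %| g ^ k.
    rewrite -expnM dvdn_exp2l //.
    by rewrite (leq_trans bk0) // (leq_trans (leq_addr (p.-1 * s) k0)) // leq_pmull.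
  exists (y * g ^ (p.-1 * L) * x).
  have -> : G (p * L) = G L + g ^ k * (g ^ (p.-1 * L) * (g ^ (p.-1 * p.-1 * L) - 1)).
    rewrite !GE -addnA -mulnDr.
    have -> : p.-1 * (p * L) = p.-1 * L + p.-1 * p.-1 * L.
      by rewrite -{2}(prednK p0) mulSn mulnDr mulnA.
    rewrite expnD.
    have : 0 < g ^ (p.-1 * L) by rewrite !expn_gt0 a0.
    have : 0 < g ^ (p.-1 * p.-1 * L) by rewrite !expn_gt0 a0.
    case: (g ^ (p.-1 * p.-1 * L)) => // y' _; case: (g ^ (p.-1 * L)) => // x' _.
    by rewrite mulSn addSn !subn1 /=; congr (_ + _ * _); ring.
  rewrite xE yE /E expnD !expnS !expn0; ring.
have gcdE : gcdn (G (p * L)) E = gcdn (G L) E.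
  by rewrite zE mulnC addnC gcdnC gcdnMDl gcdnC.
have n12 : n (p * L) = n L + E %/ gcdn (G L) E * (W ^ 2 * `|a| ^ 3 * z).
  by rewrite /n gcdE zE divnDl ?dvdn_gcdl // divn_mulAC ?dvdn_gcdr.
have : jacobi_sign a (n L) = jacobi_sign a (n (p * L)).
  apply: jacobi_sign_eqmod => //; first by rewrite -absz_gt0.
  apply/esym/eqP; rewrite n12 eqn_mod_dvd ?leq_addr // addKn dvdn_mull //.
  rewrite dvdn_mulr // (_ : W ^ 2 * _ = (W * `|a|) * (W * `|a|) * `|a|); last first.
    by rewrite !expnS !expn0; ring.
  by rewrite dvdn_mul // (_ : 4 = 2 * 2) // dvdn_mul.
by rewrite j1 j2 v1 v2 /=; case: (odd e).
Qed.

(** * An exact large sieve *)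

Local Open Scope ring_scope.

(** Multiplication by 2 sin (pi d / T), nonzero as 0 < d < T, makes the sum telescope over d full
    turns. *)
Lemma sum_cos_arith (R : realType) (A : R) (d T : nat) : (0 < d < T)%N ->
  \sum_(0 <= m < T) cos (A + pi * 2 * d%:R / T%:R * m%:R) = 0.
Proof.
move=> /andP[d0 dT]; set B := pi * 2 * d%:R / T%:R.
have Tn0 : (0 < T)%N := leq_ltn_trans (leq0n d) dT.
have T0 : (0 : R) < T%:R by rewrite ltr0n.
have s0 : sin (B / 2) != 0.
  rewrite gt_eqF // sin_gt0_pi // /B.
  have -> : pi * 2 * d%:R / T%:R / 2 = pi * (d%:R / T%:R) :> R by field; rewrite gt_eqF.
  rewrite pmulr_rgt0 ?pi_gt0 // divr_gt0 ?ltr0n //=.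
  by rewrite gtr_pMr ?pi_gt0 // ltr_pdivrMr // mul1r ltr_nat.
apply: (mulfI (mulf_neq0 (_ : 2 != 0) s0)); first by rewrite pnatr_eq0.
rewrite mulr0 mulr_sumr.
under eq_bigr => m _.
  have -> : 2 * sin (B / 2) * cos (A + B * m%:R) =
    sin (A + B * m.+1%:R - B / 2) - sin (A + B * m%:R - B / 2).
    have -> : A + B * m.+1%:R - B / 2 = A + B * m%:R + B / 2 by rewrite -natr1; field.
    by rewrite sinB sinD; ring.
  over.
rewrite (telescope_sumr (fun m : nat => sin (A + B * m%:R - B / 2))) //.
have -> : A + B * T%:R - B / 2 = A - B / 2 + pi *+ 2 *+ d.
  by rewrite /B -[pi *+ 2 *+ d]mulr_natr -[pi *+ 2]mulr_natr; field; rewrite gt_eqF.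
have -> : A + B * 0%:R - B / 2 = A - B / 2 by rewrite mulr0 addr0.
suff -> : forall n x, sin (x + pi *+ 2 *+ n) = sin x :> R by rewrite subrr.
elim=> [|n IH] x; first by rewrite mulr0n addr0.
by rewrite mulrS addrCA addrC sinD2pi IH.
Qed.

Lemma cos_ge_half (R : realType) (x : R) : `|x| <= 1 / 2 -> 1 / 2 <= cos x.
Proof.
move=> xh; have [xl xr] : - (1 / 2) <= x /\ x <= 1 / 2.
  by move: xh; rewrite ler_norml => /andP[].
have p1 := pihalf_ge1 R.
have c0 : 0 <= cos x by apply: cos_ge0_pihalf; lra.
have : 0 <= cos (x *+ 2) by apply: cos_ge0_pihalf; rewrite [x *+ 2]mulr2n; lra.
rewrite cos_mulr2n => h; rewrite leNgt; apply/negP => c1.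
have : cos x ^+ 2 < 1 / 2 by nra.
by move: h; rewrite [_ *+ 2]mulr2n; lra.
Qed.

(* A finite Fejer kernel on Z/M centred at c: its Fourier support has length
   less than H, so it is equidistributed in the classes modulo any divisor r of
   M such that H * r <= M. *)
Definition fejer (R : realType) (M H c i : nat) : R :=
  (\sum_(0 <= k < H) cos (pi * 2 / M%:R * k%:R * (i%:R - c%:R))) ^+ 2 +
  (\sum_(0 <= k < H) sin (pi * 2 / M%:R * k%:R * (i%:R - c%:R))) ^+ 2.

Lemma fejer_ge0 (R : realType) (M H c i : nat) : 0 <= fejer R M H c i.
Proof. by rewrite addr_ge0 ?sqr_ge0. Qed.

Lemma fejerE (R : realType) (M H c i : nat) : fejer R M H c i =
  \sum_(0 <= k < H) \sum_(0 <= l < H)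
    cos (pi * 2 / M%:R * (k%:R - l%:R) * (i%:R - c%:R)).
Proof.
rewrite /fejer !expr2 !big_distrlr -big_split /=; apply: eq_bigr => k _.
rewrite -big_split /=; apply: eq_bigr => l _.
by rewrite -cosB; congr cos; ring.
Qed.

(** The factor 16 keeps each phase within 2 pi / 16 < 1/2, by pi < 4, so every cosine is at least
    1/2. *)
Lemma fejer_ge (R : realType) (M H c i : nat) : (0 < M)%N ->
  `|i%:R - c%:R| * H%:R * 16 <= M%:R :> R -> (H%:R / 2) ^+ 2 <= fejer R M H c i.
Proof.
move=> M0 hi; rewrite /fejer -[leLHS]addr0 lerD ?sqr_ge0 //.
set S := \sum_(0 <= k < H) _.
have hS : H%:R / 2 <= S.
  have -> : H%:R / 2 = \sum_(0 <= k < H) (1 / 2 : R).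
    by rewrite sumr_const_nat subn0 -mulr_natr; field.
  apply: ler_sum_nat => k /= kH; apply: cos_ge_half.
  have M0' : (0 : R) < M%:R by rewrite ltr0n.
  have p4 : pi < 4 :> R by have := pihalf_lt2 R; lra.
  have p0 := pi_gt0 R.
  rewrite normrM (@ger0_norm _ (_ * k%:R)); last first.
    by rewrite mulr_ge0 // divr_ge0 // mulr_ge0 // ltW.
  rewrite -(ler_pM2r M0').
  set x := `|_| in hi *.
  have -> : pi * 2 / M%:R * k%:R * x * M%:R = pi * 2 * k%:R * x by field; rewrite gt_eqF.
  have x0 : 0 <= x by rewrite normr_ge0.
  have kx : k%:R * x <= H%:R * x by rewrite ler_wpM2r // ler_nat ltnW.
  have k0 : 0 <= k%:R * x by rewrite mulr_ge0.
  nra.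
by rewrite lerXn2r ?nnegrE ?divr_ge0 // (le_trans _ hS) ?divr_ge0.
Qed.

Lemma big_nat_blocks (R : nmodType) (F : nat -> R) (T r : nat) :
  \sum_(0 <= i < T * r) F i = \sum_(0 <= a < r) \sum_(0 <= m < T) F (a + m * r)%N.
Proof.
rewrite big_nat_mul exchange_big_nat /=.
apply: eq_bigr => m _; rewrite -{1}[(m * r)%N]add0n big_addn mulSn addnK.
by [].
Qed.

(** On a class modulo r, the (k, l) term of the kernel is summed over T = M / r equally spaced
    phases of frequency k - l. As |k - l| < H <= T, only k = l survives, and each class receives the
    weight H T. *)
Lemma fejer_sum (R : realType) (M H c r : nat) (f : nat -> R) :
  (0 < M)%N -> (r %| M)%N -> (H * r <= M)%N -> (forall i, f (i + r)%N = f i) ->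
  \sum_(0 <= i < M) fejer R M H c i * f i =
  H%:R * (M %/ r)%:R * \sum_(0 <= a < r) f a.
Proof.
move=> M0 /dvdnP[T ME] HrM fr; subst M.
have r0 : (0 < r)%N by move: M0; rewrite muln_gt0 => /andP[].
have T0 : (0 < T)%N by move: M0; rewrite muln_gt0 => /andP[].
have HT : (H <= T)%N by rewrite -(leq_pmul2r r0).
have Tr : (T * r)%:R != 0 :> R by rewrite pnatr_eq0 -lt0n.
have Tn : T%:R != 0 :> R by rewrite pnatr_eq0 -lt0n.
have rn : r%:R != 0 :> R by rewrite pnatr_eq0 -lt0n.
rewrite mulnK // big_nat_blocks mulr_sumr; apply: eq_bigr => a _.
have fa m : f (a + m * r)%N = f a.
  by elim: m => [|m IH]; rewrite ?mul0n ?addn0 // mulSn addnCA addnC fr.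
under eq_bigr do rewrite fa fejerE.
rewrite -mulr_suml; congr (_ * _).
rewrite exchange_big /=.
under eq_bigr do rewrite exchange_big /=.
have cosz k l m : cos (pi * 2 / (T * r)%:R * (k%:R - l%:R) * ((a + m * r)%:R - c%:R)) =
  cos (pi * 2 / (T * r)%:R * (k%:R - l%:R) * (a%:R - c%:R) +
       pi * 2 * (k%:R - l%:R) / T%:R * m%:R) :> R.
  by congr cos; rewrite natrD !natrM; field; rewrite Tn.
have cosw k l : (k < H)%N -> (l < k)%N -> forall x : R,
  \sum_(0 <= m < T) cos (x + pi * 2 * (k%:R - l%:R) / T%:R * m%:R) = 0.
  move=> kH lk x; rewrite -natrB ?(ltnW lk) //; apply: sum_cos_arith.
  by rewrite subn_gt0 lk (leq_ltn_trans (leq_subr _ _)) // (leq_trans kH).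
have key k l : (k < H)%N -> (l < H)%N ->
  \sum_(0 <= m < T) cos (pi * 2 / (T * r)%:R * (k%:R - l%:R) * ((a + m * r)%:R - c%:R)) =
  (if k == l then T%:R else 0 : R).
  move=> kH lH; under eq_bigr do rewrite cosz.
  case: (ltngtP k l) => [kl|lk|->].
  - under eq_bigr => m _.
      rewrite -cosN.
      have -> : - (pi * 2 / (T * r)%:R * (k%:R - l%:R) * (a%:R - c%:R) +
          pi * 2 * (k%:R - l%:R) / T%:R * m%:R) =
        - (pi * 2 / (T * r)%:R * (k%:R - l%:R) * (a%:R - c%:R)) +
          pi * 2 * (l%:R - k%:R) / T%:R * m%:R :> R by field; rewrite Tn.
      over.
    exact: cosw.
  - exact: cosw.
  under eq_bigr do rewrite subrr !(mulr0, mul0r) addr0 cos0.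
  by rewrite sumr_const_nat subn0.
transitivity (\sum_(0 <= k < H) T%:R : R).
  apply: eq_big_nat => k /= kH.
  rewrite (eq_big_nat _ _ (F2 := fun l => if k == l then T%:R else 0 : R)).
    rewrite -big_mkcond /= (big_rem k) ?mem_index_iota //= eqxx big_seq_cond big1 ?addr0 //.
    move=> l /andP[lI /eqP kl]; move: lI; rewrite -kl mem_rem_uniqF ?iota_uniq //.
  by move=> l /= lH; exact: key.
by rewrite sumr_const_nat subn0 mulr_natl.
Qed.

Lemma sum_mulp_period (R : nmodType) (p q x : nat) (f : nat -> R) :
  coprime p q -> (0 < q)%N -> (forall i, f (i + q)%N = f i) ->
  \sum_(0 <= m < q) f (x + m * p)%N = \sum_(0 <= y < q) f y.
Proof.
move=> cpq q0 fq.
have fm i : f (i %% q)%N = f i.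
  rewrite {2}(divn_eq i q) addnC.
  by elim: (i %/ q)%N => [|k IH]; rewrite ?mul0n ?addn0 // mulSn addnCA addnC fq.
have inj : {in iota 0 q &, injective (fun m => (x + m * p) %% q)%N}.
  move=> m m'; rewrite !mem_iota /= !add0n => mq m'q /eqP.
  rewrite eqn_modDl => E; wlog le : m m' mq m'q E / (m <= m')%N.
    by move=> W; case: (leqP m m') => [|/ltnW] h; [|symmetry]; apply: W; rewrite // eq_sym.
  move: E; rewrite eq_sym eqn_mod_dvd ?leq_mul2r ?le ?orbT // -mulnBl.
  rewrite Gauss_dvdl 1?coprime_sym //.
  have [//|d0] := posnP (m' - m)%N.
    by move/eqP; rewrite subn_eq0 => h _; apply/eqP; rewrite eqn_leq le.
  by move/(dvdn_leq d0) => h; exfalso; move: h; rewrite leqNgt (leq_ltn_trans (leq_subr _ _)).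
have pE : perm_eq [seq ((x + m * p) %% q)%N | m <- iota 0 q] (iota 0 q).
  have us : uniq [seq ((x + m * p) %% q)%N | m <- iota 0 q].
    by rewrite map_inj_in_uniq ?iota_uniq.
  apply: uniq_perm; rewrite ?iota_uniq //.
  have ss : {subset [seq ((x + m * p) %% q)%N | m <- iota 0 q] <= iota 0 q}.
    by move=> _ /mapP[m _ ->]; rewrite mem_iota add0n ltn_pmod.
  by case: (uniq_min_size us ss); rewrite ?size_map.
rewrite /index_iota subn0 -[RHS](perm_big _ pE) big_map.
by apply: eq_bigr => m _; rewrite fm.
Qed.

(** Chinese remainders: on a fixed class modulo p, f is constant while i runs through all classes
    modulo q. *)
Lemma sum_period_mul_eq0 (R : pzRingType) (p q : nat) (f g : nat -> R) :
  coprime p q -> (0 < q)%N ->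
  (forall i, f (i + p)%N = f i) -> (forall i, g (i + q)%N = g i) ->
  \sum_(0 <= y < q) g y = 0 -> \sum_(0 <= i < q * p) f i * g i = 0.
Proof.
move=> cpq q0 fp gq g0; rewrite big_nat_blocks big1 // => x _.
have fx m : f (x + m * p)%N = f x.
  by elim: m => [|m IH]; rewrite ?mul0n ?addn0 // mulSn addnCA addnC fp.
under eq_bigr do rewrite fx.
by rewrite -mulr_sumr sum_mulp_period // g0 mulr0.
Qed.

(** Weight by the kernel with H the product of P and M = Q^2 H, which is at least (H/2)^2 on [0, 2N]
    by 16 N <= Q^2. After the square is expanded, p q <= Q^2 lets [fejer_sum] apply: off-diagonal
    terms vanish exactly, and each diagonal one is at most H M. *)
Lemma large_sieve (R : realType) (P : seq nat) (N Q : nat) (f : nat -> nat -> R) :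
  uniq P -> (forall p, p \in P -> prime p && (p <= Q)%N) ->
  (0 < N)%N -> (16 * N <= Q ^ 2)%N ->
  (forall p i, p \in P -> f p (i + p)%N = f p i) ->
  (forall p, p \in P -> \sum_(0 <= i < p) f p i = 0) ->
  (forall p i, `|f p i| <= 1) ->
  \sum_(0 <= i < (2 * N).+1) (\sum_(p <- P) f p i) ^+ 2
    <= 4 * (size P)%:R * (Q ^ 2)%:R.
Proof.
move=> uP PQ N0 NQ fper f0 f1.
set H := (\prod_(p <- P) p)%N; set M := (Q ^ 2 * H)%N.
have H0 : (0 < H)%N.
  by rewrite /H big_seq prodn_cond_gt0 // => p /PQ /andP[/prime_gt0].
have Q0 : (0 < Q ^ 2)%N by apply: leq_trans NQ; rewrite muln_gt0.
have M0 : (0 < M)%N by rewrite muln_gt0 Q0.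
have pH p : p \in P -> (p %| H)%N by move=> pP; rewrite /H (big_rem p) //= dvdn_mulr.
have HR : (0 : R) < H%:R by rewrite ltr0n.
set S := fun i => \sum_(p <- P) f p i.
have step1 : (H%:R / 2) ^+ 2 * \sum_(0 <= i < (2 * N).+1) S i ^+ 2 <=
    \sum_(0 <= i < M) fejer R M H N i * S i ^+ 2.
  have NM : ((2 * N).+1 <= M)%N.
    rewrite (leq_trans _ (leq_pmulr _ H0)) // (leq_trans _ NQ) //; lia.
  rewrite [leRHS](@big_cat_nat _ _ _ (2 * N).+1) //= -[leLHS]addr0 lerD //.
    rewrite mulr_sumr; apply: ler_sum_nat => i /= iN.
    rewrite ler_wpM2r ?sqr_ge0 // fejer_ge //.
    have : `|i%:R - N%:R| <= N%:R :> R.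
      rewrite ler_norml; have : (i%:R <= 2 * N%:R :> R) by rewrite -natrM ler_nat -ltnS.
      have : (0 <= i%:R :> R) by []. lra.
    move=> /(ler_wpM2r (ltW HR)) h; rewrite mulrAC.
    apply: le_trans (_ : N%:R * H%:R * 16 <= _); first lra.
    by rewrite -!natrM ler_nat /M mulnAC leq_mul2r mulnC NQ orbT.
  by apply: sumr_ge0 => i _; rewrite mulr_ge0 ?fejer_ge0 ?sqr_ge0.
have step2 : \sum_(0 <= i < M) fejer R M H N i * S i ^+ 2 =
    \sum_(p <- P) \sum_(q <- P) \sum_(0 <= i < M) fejer R M H N i * (f p i * f q i).
  under eq_bigr => i _.
    rewrite expr2 /S big_distrlr /= mulr_sumr.
    under eq_bigr do rewrite mulr_sumr.
    over.
  by rewrite exchange_big /=; apply: eq_bigr => p _; rewrite exchange_big.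
have step3 p q : p \in P -> q \in P ->
  \sum_(0 <= i < M) fejer R M H N i * (f p i * f q i) <=
  (if p == q then H%:R * M%:R else 0).
  move=> pP qP; have /andP[pp pQ] := PQ _ pP; have /andP[qp qQ] := PQ _ qP.
  have p0 := prime_gt0 pp.
  case: eqVneq => [<-|pq].
    rewrite (@fejer_sum R M H N p (fun i => f p i * f p i)) //; last 3 first.
    - by rewrite dvdn_mull ?pH.
    - rewrite /M mulnC leq_mul2r -[p]muln1; apply/orP; right.
      by rewrite expnS expn1 leq_mul // (leq_trans p0).
    - by move=> i; rewrite fper.
    have : \sum_(0 <= a < p) f p a * f p a <= p%:R.
      apply: le_trans (_ : \sum_(0 <= a < p) 1 <= _); last by rewrite sumr_const_nat subn0.
      apply: ler_sum_nat => a _; rewrite -expr2 -real_normK ?num_real //.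
      by rewrite expr_le1 ?normr_ge0 // f1.
    move=> h; rewrite -mulrA ler_wpM2l // (le_trans (ler_wpM2l _ h)) //.
    by rewrite -natrM divnK // dvdn_mull ?pH.
  have cpq : coprime p q by rewrite prime_coprime // dvdn_prime2.
  rewrite (@fejer_sum R M H N (q * p)%N (fun i => f p i * f q i)) //; last 3 first.
  - by rewrite dvdn_mull // Gauss_dvd 1?coprime_sym // !pH.
  - by rewrite /M mulnC leq_mul2r expnS expn1 leq_mul ?orbT.
  - move=> i; congr (_ * _).
      by elim: q {qP qp qQ pq cpq} => [|q IH]; rewrite ?addn0 // mulSn addnCA addnC fper.
    elim: p {pP pp pQ p0 pq cpq} => [|p IH]; rewrite ?muln0 ?addn0 // mulnS addnCA addnC.
    by rewrite fper.
  by rewrite (@sum_period_mul_eq0 _ p q) ?mulr0 ?(prime_gt0 qp) ?f0 // => i; rewrite fper.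
have step4 : (H%:R / 2) ^+ 2 * \sum_(0 <= i < (2 * N).+1) S i ^+ 2 <=
   (size P)%:R * (H%:R * M%:R).
  apply: (le_trans step1); rewrite step2.
  apply: le_trans (_ : \sum_(p <- P) H%:R * M%:R <= _); last first.
    by rewrite big_const_seq count_predT iter_addr_0 -[leLHS]mulr_natl.
  rewrite big_seq [leRHS]big_seq; apply: ler_sum => p pP.
  apply: le_trans (_ : \sum_(q <- P) (if p == q then H%:R * M%:R else 0) <= _).
    by rewrite big_seq [leRHS]big_seq; apply: ler_sum => q qP; exact: step3.
  rewrite -big_mkcond /= (big_rem p) //= eqxx big_seq_cond big1 ?addr0 //.
  by move=> q /andP[qI /eqP pq]; move: qI; rewrite -pq mem_rem_uniqF.
have H2 : (0 : R) < (H%:R / 2) ^+ 2 by rewrite exprn_gt0 // divr_gt0.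
rewrite -(ler_pM2l H2); apply: (le_trans step4).
by rewrite /M natrM le_eqVlt; apply/orP; left; apply/eqP; field.
Qed.

Lemma sum_shift_Fp (R : nmodType) (p N : nat) (F : 'F_p -> R) : prime p ->
  \sum_(0 <= i < p) F (i%:R - N%:R) = \sum_(r : 'F_p) F r.
Proof.
move=> pp; rewrite (reindex (fun r : 'F_p => r - N%:R)) /=; last first.
  by exists (fun r => r + N%:R) => r _; rewrite ?subrK ?addrK.
have E := Fp_cast pp.
rewrite big_mkord (reindex (fun r : 'F_p => cast_ord E r)) /=; last first.
  by exists (cast_ord (esym E)) => r _; rewrite ?cast_ordK ?cast_ordKV.
by apply: eq_bigr => r _; congr (F (_ - _)); rewrite natr_Zp.
Qed.

(** A variance bound: the indicators of A p are centred at their means, which total at least delta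
    |P|. At a counted index the centred sum is at most - delta |P| / 2. *)
Lemma large_sieve_count (R : realType) (P : seq nat) (N Q : nat)
    (A : forall p, pred 'F_p) (delta : R) :
  uniq P -> (forall p, p \in P -> prime p && (p <= Q)%N) ->
  (0 < N)%N -> (16 * N <= Q ^ 2)%N -> 0 < delta ->
  (forall p, p \in P -> delta * p%:R <= #|A p|%:R) ->
  (count (fun i => (count (fun p => A p (i%:R - N%:R)) P)%:R <= delta / 2 * (size P)%:R)
     (iota 0 (2 * N).+1))%:R * (delta ^+ 2 * (size P)%:R) <= 16 * (Q ^ 2)%:R.
Proof.
move=> uP PQ N0 NQ d0 dA.
have pR p : p \in P -> (0 : R) < p%:R by case/PQ/andP=> /prime_gt0; rewrite ltr0n.
pose om p : R := #|A p|%:R / p%:R.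
(* The value 0 outside P secures the bound 1 at all p, as [large_sieve] demands. *)
pose f p i : R := if p \in P then (A p (i%:R - N%:R))%:R - om p else 0.
have om01 p : p \in P -> 0 <= om p <= 1.
  move=> pP; have /andP[pp _] := PQ _ pP; rewrite /om divr_ge0 //=.
  by rewrite ler_pdivrMr ?pR // mul1r ler_nat -[leqRHS](card_Fp pp) max_card.
have LS : \sum_(0 <= i < (2 * N).+1) (\sum_(p <- P) f p i) ^+ 2
    <= 4 * (size P)%:R * (Q ^ 2)%:R.
  apply: large_sieve => //.
  - move=> p i pP; rewrite /f pP; have /andP[pp _] := PQ _ pP.
    by rewrite natrD pchar_Fp_0 // addr0.
  - move=> p pP; rewrite /f pP; have /andP[pp _] := PQ _ pP.
    rewrite sumrB (@sum_shift_Fp _ p N (fun r => (A p r)%:R)) //.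
    have cA : (\sum_(r : 'F_p) (A p r : nat))%N = #|A p|.
      rewrite -sum1_card [RHS]big_mkcond; apply: eq_bigr => r _.
      by rewrite unfold_in; case: (A p r).
    rewrite sumr_const_nat subn0 -natr_sum /om -[X in _ - X]mulr_natr.
    by rewrite divfK ?gt_eqF ?pR // cA subrr.
  - move=> p i; rewrite /f; case: ifP => pP; last by rewrite normr0.
    have := om01 p pP; case: (A p _) => /= /andP[h1 h2]; rewrite ler_norml; lra.
set bad := fun i => _ <= delta / 2 * _.
set K : R := (size P)%:R in LS *.
have K0 : 0 <= K by rewrite /K.
have badP i : bad i -> delta ^+ 2 * K ^+ 2 / 4 <= (\sum_(p <- P) f p i) ^+ 2.
  rewrite /bad => hb.
  have E : \sum_(p <- P) f p i =
      (count (fun p => A p (i%:R - N%:R)) P)%:R - \sum_(p <- P) om p.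
    rewrite -sum1_count natr_sum [X in _ = X - _]big_mkcond /= -sumrB big_seq [RHS]big_seq.
    by apply: eq_bigr => p pP; rewrite /f pP; case: (A p _).
  have oK : delta * K <= \sum_(p <- P) om p.
    have -> : delta * K = \sum_(p <- P) delta.
      by rewrite big_const_seq count_predT iter_addr_0 mulr_natr.
    rewrite big_seq [leRHS]big_seq; apply: ler_sum => p pP.
    by rewrite /om ler_pdivlMr ?pR // dA.
  have h : delta / 2 * K <= - \sum_(p <- P) f p i by rewrite E; move: hb oK; rewrite -/K; lra.
  have dK : 0 <= delta / 2 * K by rewrite mulr_ge0 // divr_ge0 // ltW.
  rewrite -[leRHS]sqrrN (_ : _ / 4 = (delta / 2 * K) ^+ 2); last by field.
  have h0 := le_trans dK h.
  by rewrite ler_sqr ?nnegrE.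
have : (count bad (iota 0 (2 * N).+1))%:R * (delta ^+ 2 * K ^+ 2 / 4) <= 4 * K * (Q ^ 2)%:R.
  apply: le_trans LS; rewrite -sum1_count natr_sum [X in X * _ <= _]big_mkcond mulr_suml /=.
  rewrite /index_iota subn0; apply: ler_sum => i _.
  by case: ifP => [/badP|_]; rewrite ?mul1r // mul0r sqr_ge0.
move=> h; have [K00|Kp] : K = 0 \/ 0 < K.
- by move: K0; rewrite le_eqVlt => /orP[/eqP <-|]; [left|right].
- by rewrite K00 !mulr0.
rewrite -(ler_pM2r Kp); nra.
Qed.

(** * Primes p with few small prime factors of p - 1 *)

Local Open Scope nat_scope.

Definition primes_upto (x : nat) : seq nat := [seq p <- iota 0 x.+1 | prime p].

Lemma mem_primes_upto x p : (p \in primes_upto x) = prime p && (p <= x).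
Proof. by rewrite mem_filter mem_iota. Qed.

Lemma uniq_primes_upto x : uniq (primes_upto x).
Proof. by rewrite filter_uniq ?iota_uniq. Qed.

(** * Chebyshev's lower bound for the number of primes *)

Lemma expn2_le_bin n : 2 ^ n <= 'C(2 * n, n).
Proof.
elim: n => [|n IH]; first by rewrite bin0.
rewrite (_ : 2 * n.+1 = (2 * n).+2); last by lia.
rewrite expnS binS.
have <- : 'C((2 * n).+1, n.+1) = 'C((2 * n).+1, n).
  by rewrite -bin_sub; [congr binomial|]; lia.
by rewrite addnn -mul2n leq_mul2l /= binS (leq_trans IH) // leq_addl.
Qed.

(** In Legendre's formula each p^k contributes the floor of 2 n / p^k minus twice that of n / p^k:
    this is 0 or 1, and 0 once p^k > 2 n. *)
Lemma logn_bin_le p n : prime p -> 0 < n -> p ^ logn p 'C(2 * n, n) <= 2 * n.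
Proof.
move=> pp n0; have p1 := prime_gt1 pp.
have n20 : 0 < 2 * n by rewrite muln_gt0.
suff h : logn p 'C(2 * n, n) <= trunc_log p (2 * n).
  by apply: leq_trans (trunc_logP p1 n20); rewrite leq_exp2l.
have C0 : 0 < 'C(2 * n, n) by rewrite bin_gt0; lia.
have lsum : logn p n`! = \sum_(1 <= k < (2 * n).+1) n %/ p ^ k.
  rewrite logn_fact // [RHS](@big_cat_nat _ _ _ n.+1) //=; last by lia.
  rewrite [X in _ = _ + X]big_nat_cond [X in _ = _ + X]big1 ?addn0 // => k /andP[/andP[nk _] _].
  by rewrite divn_small // (leq_trans nk) // ltnW // ltn_expl.
have n2n : n <= 2 * n by rewrite leq_pmull.
have := congr1 (logn p) (bin_fact n2n).
rewrite (_ : 2 * n - n = n); last by lia.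
rewrite !lognM ?muln_gt0 ?fact_gt0 // lsum logn_fact // addnn -mul2n.
have -> : \sum_(1 <= k < (2 * n).+1) 2 * n %/ p ^ k =
  2 * \sum_(1 <= k < (2 * n).+1) n %/ p ^ k +
  \sum_(1 <= k < (2 * n).+1) (2 * n %/ p ^ k - 2 * (n %/ p ^ k)).
  rewrite big_distrr -big_split /=; apply: eq_bigr => k _.
  by rewrite subnKC // leq_divRL ?expn_gt0 ?prime_gt0 // -mulnA leq_mul2l leq_divM.
rewrite addnC => /addnI ->.
apply: leq_trans (_ : \sum_(1 <= k < (2 * n).+1) (k <= trunc_log p (2 * n)) <= _).
  apply: leq_sum => k _.
  have pk : 0 < p ^ k by rewrite expn_gt0 prime_gt0.
  case: (leqP k (trunc_log p (2 * n))) => h /=.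
    by rewrite leq_subLR -ltnS ltn_divLR //; have := ltn_ceil n pk; lia.
  rewrite divn_small // (leq_trans (trunc_log_ltn _ p1)) //.
  by rewrite leq_exp2l.
by rewrite sum_leq_minn geq_minr.
Qed.

Lemma chebyshev_lower n : 0 < n -> 2 ^ n <= (2 * n) ^ size (primes_upto (2 * n)).
Proof.
move=> n0; apply: (leq_trans (expn2_le_bin n)).
have C0 : 0 < 'C(2 * n, n) by rewrite bin_gt0; lia.
have n20 : 0 < 2 * n by rewrite muln_gt0.
rewrite {1}(prod_prime_decomp C0) prime_decompE big_map /=.
apply: leq_trans (_ : \prod_(p <- primes 'C(2 * n, n)) (2 * n) <= _).
  rewrite big_seq [leqRHS]big_seq; apply: leq_prod => p.
  by rewrite mem_primes => /andP[pp _]; exact: logn_bin_le.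
rewrite big_const_seq count_predT -Monoid.iteropE -[iterop _ _ _ _]/(_ ^ _).
rewrite leq_pexp2l // uniq_leq_size ?primes_uniq // => p.
rewrite mem_primes mem_primes_upto => /and3P[pp _ pC]; rewrite pp /=.
apply: leq_trans (logn_bin_le pp n0).
by rewrite -{1}[p]expn1 leq_exp2l ?prime_gt1 // -pfactor_dvdn // expn1.
Qed.

(** * An upper bound for primes congruent to 1 modulo q *)

Lemma prod_uniq_primes_dvd (s : seq nat) m : uniq s ->
  (forall p, p \in s -> prime p && (p %| m)) -> \prod_(p <- s) p %| m.
Proof.
elim: s => [|p s IH] /=; first by rewrite big_nil dvd1n.
case/andP=> ps us H; rewrite big_cons.
have /andP[pp pm] := H p (mem_head _ _).
rewrite Gauss_dvd ?pm ?IH // => [q qs|]; first by rewrite H // inE qs orbT.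
rewrite prime_coprime // Euclid_dvd_prod // big_has -all_predC.
apply/allP => q qs /=.
have /andP[qp _] : prime q && (q %| m) by apply: H; rewrite inE qs orbT.
by rewrite dvdn_prime2 //; apply: contraNneq ps => ->.
Qed.

Lemma prime_dvd_fact p n : prime p -> p %| n`! -> p <= n.
Proof.
move=> pp; rewrite fact_prod Euclid_dvd_prod // big_has => /hasP[i].
by rewrite mem_index_iota => hi /dvdn_leq; lia.
Qed.

Lemma sum_div_expn_le q n K : 1 < q -> \sum_(1 <= k < K.+1) n %/ q ^ k <= n.
Proof.
move=> q1; elim: K n => [|K IH] n; first by rewrite big_nil.
rewrite big_nat_recl //= expn1.
under eq_bigr do rewrite expnS divnMA.
apply: leq_trans (leq_add (leqnn _) (IH _)) _.
rewrite addnn -muln2 (leq_trans _ (leq_divM n q)) // leq_mul2l q1 orbT //.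
Qed.

(* Modulo a power of a prime l <> q the number q is invertible, so the product is
   a multiple of a product of n consecutive integers. *)
Lemma fact_dvd_prod_arith q n : prime q ->
  n`! %| q ^ n * \prod_(1 <= j < n.+1) (q * j + 1).
Proof.
move=> qp; set B := q ^ n * _.
have B0 : 0 < B.
  rewrite muln_gt0 expn_gt0 prime_gt0 //= prodn_cond_gt0 // => j _.
  by rewrite addn1.
apply/dvdn_partP; first exact: fact_gt0.
move=> l; rewrite mem_primes => /andP[lp _]; rewrite p_part.
case: (eqVneq l q) => [->|lq].
  rewrite dvdn_mulr // dvdn_exp2l // logn_fact //.
  exact: sum_div_expn_le (prime_gt1 qp).
set v := logn l n`!; rewrite dvdn_mull //.
have clq : coprime (l ^ v) q by rewrite coprimeXl // prime_coprime // dvdn_prime2.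
have lv0 : 0 < l ^ v by rewrite expn_gt0 prime_gt0.
have [c cE] : exists c, q * c = 1 %[mod l ^ v].
  have [/= a b E _] := egcdnP (l ^ v) (prime_gt0 qp).
  exists a; rewrite mulnC E; move: clq; rewrite coprime_sym => /eqP ->.
  by rewrite modnMDl.
have : \prod_(1 <= j < n.+1) (q * j + 1) =
  q ^ n * \prod_(1 <= j < n.+1) (j + c) %[mod l ^ v].
  have -> : q ^ n * \prod_(1 <= j < n.+1) (j + c) = \prod_(1 <= j < n.+1) (q * (j + c)).
    by rewrite big_split /= prod_nat_const_nat subn1.
  elim/big_ind2: _ => // [x1 x2 y1 y2 h1 h2|j _].
    by rewrite -modnMm h1 h2 modnMm.
  by rewrite mulnDr -modnDmr -cE modnDmr.
rewrite /dvdn => ->.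
suff h : n`! %| \prod_(1 <= j < n.+1) (j + c).
  by apply: dvdn_mull; apply: dvdn_trans h; rewrite /v -p_part dvdn_part.
have -> : \prod_(1 <= j < n.+1) (j + c) = (n + c) ^_ n.
  elim: n {B B0 v clq lv0 cE} => [|n IH]; first by rewrite big_nil ffactn0.
  by rewrite big_nat_recr //= IH addSn ffactSS mulnC.
by rewrite -bin_ffact dvdn_mull.
Qed.

Definition primes_1mod (q x : nat) : seq nat :=
  [seq p <- primes_upto x | q %| p.-1].

(** The primes above n are q j + 1 with 1 <= j <= n and are prime to n!, so their product divides
    the quotient in [fact_dvd_prod_arith]; q j + 1 <= (q + 1) j bounds that quotient. *)
Lemma prod_primes_1mod_step q x : prime q ->
  \prod_(p <- primes_1mod q x) p <=
  (q * q.+1) ^ (x.-1 %/ q) * \prod_(p <- primes_1mod q (x.-1 %/ q)) p.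
Proof.
move=> qp; set n := x.-1 %/ q; set s := primes_1mod q x.
have q1 := prime_gt1 qp; have q0 := prime_gt0 qp.
have nx : n <= x by rewrite (leq_trans (leq_div _ _)) // leq_pred.
rewrite (bigID (fun p => n < p)) /=; apply: leq_mul; last first.
  rewrite -big_filter (perm_big (primes_1mod q n)) //.
  apply: uniq_perm => [||p]; [by rewrite !filter_uniq ?iota_uniq..|].
  rewrite !(mem_filter, mem_iota) /= !add0n !ltnS -leqNgt.
  case: (leqP p n) => pn; rewrite ?andbF //= (leq_trans pn nx).
  by case: (prime p); rewrite ?andbT ?andbF.
rewrite -big_filter.
have /dvdnP[c cE] := fact_dvd_prod_arith n qp.
have c0 : 0 < c.
  case: (posnP c) cE => // -> /esym/eqP; rewrite mul0n eq_sym eqn0Ngt muln_gt0.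
  by rewrite expn_gt0 q0 /= prodn_cond_gt0 // => j _; rewrite addn1.
apply: (@leq_trans c).
  apply: dvdn_leq => //; apply: prod_uniq_primes_dvd.
    by rewrite !filter_uniq ?iota_uniq.
  move=> p; rewrite !mem_filter mem_iota => /and4P[np qp1 pp /andP[_ px]].
  rewrite pp /= -(@Gauss_dvdl _ _ n`!); last first.
    rewrite prime_coprime //; apply/negP => /(prime_dvd_fact pp).
    by rewrite leqNgt np.
  rewrite -cE dvdn_mull //.
  have p1 := prime_gt1 pp; have pE := prednK (prime_gt0 pp).
  have jn : 0 < p.-1 %/ q < n.+1.
    rewrite divn_gt0 // dvdn_leq //=; last by rewrite -ltnS pE.
    by rewrite ltnS /n leq_div2r // -!subn1 leq_sub2r.
  rewrite (big_rem (p.-1 %/ q)) ?mem_index_iota //= dvdn_mulr //.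
  by rewrite mulnC divnK // addn1 pE.
rewrite -(leq_pmul2r (fact_gt0 n)) -cE expnMn -mulnA leq_mul2l; apply/orP; right.
apply: leq_trans (_ : \prod_(1 <= j < n.+1) (q.+1 * j) <= _).
  rewrite big_nat [leqRHS]big_nat; apply: leq_prod => j /andP[j0 _].
  by rewrite mulSn addnC leq_add2r.
by rewrite big_split /= prod_nat_const_nat subn1 -fact_prod.
Qed.

(** With n = (x - 1) / q, one step contributes the exponent n (q - 1) and induction n; their sum n q
    is at most x. *)
Lemma prod_primes_1mod_le q x : prime q ->
  (\prod_(p <- primes_1mod q x) p) ^ q.-1 <= (q * q.+1) ^ x.
Proof.
move=> qp; have q1 := prime_gt1 qp; have q0 := prime_gt0 qp.
elim/ltn_ind: x => x IH; case: (posnP x) => [->|x0].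
  by rewrite /primes_1mod /primes_upto /= big_nil exp1n.
set n := x.-1 %/ q.
have nx : n < x by rewrite (leq_ltn_trans (leq_div _ _)) // prednK.
have h := prod_primes_1mod_step x qp.
apply: leq_trans (_ : ((q * q.+1) ^ n * \prod_(p <- primes_1mod q n) p) ^ q.-1 <= _).
  by rewrite leq_exp2r // -ltnS prednK.
rewrite expnMn; apply: leq_trans (leq_mul (leqnn _) (IH n nx)) _.
rewrite -expnM -expnD leq_pexp2l ?muln_gt0 ?q0 //.
rewrite -{2}[n]muln1 -mulnDr addn1 prednK // (leq_trans (leq_divM _ _)) //.
exact: leq_pred.
Qed.

Local Open Scope ring_scope.

Lemma ln_natX_le (R : realType) (a b m n : nat) : (0 < a)%N -> (0 < b)%N ->
  (a ^ m <= b ^ n)%N -> m%:R * ln (a%:R : R) <= n%:R * ln b%:R.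
Proof.
move=> a0 b0 h; rewrite !mulr_natl -!lnXn ?ltr0n // ler_ln ?posrE ?exprn_gt0 ?ltr0n //.
by rewrite -!natrX ler_nat.
Qed.

Lemma ln_nat_ge0 (R : realType) (n : nat) : 0 <= ln (n%:R : R).
Proof.
case: n => [|n]; first by rewrite ln0.
by rewrite ln_ge0 // ler1n.
Qed.

Lemma size_primes_upto_ge (R : realType) (x : nat) : (2 <= x)%N ->
  ln 2 / 4 * x%:R <= (size (primes_upto x))%:R * ln (x%:R : R).
Proof.
move=> x2; have n0 : (0 < x./2)%N by lia.
have nx : (2 * x./2 <= x)%N by lia.
have sub : (size (primes_upto (2 * x./2)) <= size (primes_upto x))%N.
  apply: uniq_leq_size (uniq_primes_upto _) _ => p.
  by rewrite !mem_primes_upto => /andP[-> h]; exact: leq_trans nx.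
have : (2 ^ x./2 <= x ^ size (primes_upto x))%N.
  apply: leq_trans (chebyshev_lower n0) _.
  apply: leq_trans (_ : x ^ size (primes_upto (2 * x./2)) <= _)%N.
    by case: (size _) => // k; rewrite leq_exp2r.
  by rewrite leq_pexp2l //; lia.
move=> /(@ln_natX_le R 2 x _ _ (erefl _)) h.
apply: le_trans (h (ltac:(lia))).
have l2 : 0 <= ln 2 :> R := ln_nat_ge0 R 2.
have : x%:R <= 4 * (x./2)%:R :> R by rewrite -natrM ler_nat; lia.
nra.
Qed.

Lemma sqrt_nat_exists (x : nat) : exists m : nat, (m ^ 2 <= x < m.+1 ^ 2)%N.
Proof.
have ex : exists m : nat, (x < m.+1 ^ 2)%N by exists x; nia.
case: (ex_minnP ex) => m mP mmin; exists m; rewrite mP andbT.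
case: m mP mmin => // m mP mmin; rewrite leqNgt; apply/negP => h.
by have := mmin m h; rewrite ltnn.
Qed.

(** Above sqrt x one has ln p > (ln x) / 2, so a bound on a product of such primes bounds their
    number. *)
Definition large_primes (x : nat) : seq nat :=
  [seq p <- primes_upto x | x < p ^ 2]%N.

Lemma mem_large_primes x p :
  (p \in large_primes x) = [&& prime p, p <= x & x < p ^ 2]%N.
Proof. by rewrite mem_filter mem_primes_upto andbC andbA. Qed.

Lemma size_large_primes_ge (R : realType) : exists2 c : R, 0 < c &
  exists x0 : nat, forall x, (x0 <= x)%N ->
    c * x%:R <= (size (large_primes x))%:R * ln (x%:R : R).
Proof.
have l2 : 0 < ln 2 :> R by rewrite ln_gt0 // ltr1n.
set lam : R := ln 2 / 4; have lam0 : 0 < lam by rewrite divr_gt0.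
exists (lam / 2); first by rewrite divr_gt0.
(* With y = x^(1/4), the primes up to sqrt x cost at most y^2 ln x <= 4 y^3, which is below lam y^4
   / 2 once y >= 8 / lam. *)
exists (maxn 2 (Num.truncn ((8 / lam) ^+ 4)).+1) => x; rewrite geq_max => /andP[x2 xt].
have X0 : (0 : R) < x%:R by rewrite ltr0n; lia.
have [m /andP[m2 xm]] := sqrt_nat_exists x.
have sz : (size (primes_upto x) <= size (large_primes x) + m)%N.
  rewrite /large_primes size_filter -(count_predC (fun p => x < p ^ 2)%N (primes_upto x)).
  rewrite leq_add2l -size_filter -[leqRHS](size_iota 1).
  apply: uniq_leq_size; first by rewrite !filter_uniq ?iota_uniq.
  move=> p; rewrite mem_filter mem_primes_upto mem_iota /= -leqNgt => /and3P[px pp _].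
  rewrite prime_gt0 //= add1n; have : (p ^ 2 < m.+1 ^ 2)%N := leq_ltn_trans px xm.
  by rewrite ltn_exp2r.
have h1 := size_primes_upto_ge R x2.
have lx0 := ln_nat_ge0 R x.
have szR : (size (primes_upto x))%:R <= (size (large_primes x))%:R + m%:R :> R.
  by rewrite -natrD ler_nat.
suff h2 : m%:R * ln (x%:R : R) <= lam / 2 * x%:R.
  have : (size (primes_upto x))%:R * ln (x%:R : R) <=
    ((size (large_primes x))%:R + m%:R) * ln (x%:R : R) by rewrite ler_wpM2r.
  by move: h1; rewrite -/lam; lra.
set y : R := Num.sqrt (Num.sqrt x%:R).
have y0 : 0 < y by rewrite !sqrtr_gt0.
have y2 : y ^+ 2 = Num.sqrt x%:R by rewrite sqr_sqrtr ?sqrtr_ge0.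
have y4 : y ^+ 4 = x%:R by rewrite (exprM y 2 2) y2 sqr_sqrtr ?(ltW X0).
have my : m%:R <= y ^+ 2.
  rewrite y2 -(@ler_sqr _ _ (Num.sqrt _)) ?nnegrE ?sqrtr_ge0 //.
  by rewrite sqr_sqrtr ?(ltW X0) // -natrX ler_nat.
have lny : ln x%:R <= 4 * y.
  rewrite -y4 lnXn // -[ln y *+ 4]mulr_natl ler_wpM2l // (le_trans _ (_ : y - 1 <= _)) //; last lra.
  have := @le_ln1Dx R (y - 1); rewrite addrCA subrr addr0; apply; lra.
have yl : 8 / lam <= y.
  have h0 : 0 <= 8 / lam by rewrite divr_ge0 // ltW.
  rewrite -(@ler_pXn2r _ 4) ?nnegrE ?(ltW y0) // y4.
  apply: ltW; apply: lt_le_trans (_ : (Num.truncn ((8 / lam) ^+ 4)).+1%:R <= _).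
    by have /andP[] := truncn_itv (exprn_ge0 4 h0).
  by rewrite ler_nat.
apply: le_trans (_ : y ^+ 2 * (4 * y) <= _); first by rewrite ler_pM.
rewrite -y4 (_ : lam / 2 * y ^+ 4 = y ^+ 3 * (lam * y / 2)); last by field.
rewrite (_ : _ * (4 * y) = y ^+ 3 * 4); last by ring.
rewrite ler_pM2l ?exprn_gt0 //.
have : 8 <= lam * y by rewrite mulrC -ler_pdivrMr.
lra.
Qed.

Lemma count_1mod_large_primes (R : realType) (q x : nat) : prime q -> (0 < x)%N ->
  (count (fun p => q %| p.-1)%N (large_primes x))%:R * ln (x%:R : R) * (q%:R - 1)
  <= 2 * x%:R * ln (q * q.+1)%:R.
Proof.
move=> qp x0; have q0 := prime_gt0 qp.
set s := [seq p <- large_primes x | q %| p.-1]%N.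
have sF : (\prod_(p <- s) p <= \prod_(p <- primes_1mod q x) p)%N.
  rewrite /s /large_primes -filter_predI big_filter /primes_1mod big_filter.
  rewrite [leqRHS](bigID (fun p => x < p ^ 2))%N /= leq_pmulr //.
  rewrite big_seq_cond prodn_cond_gt0 // => p /andP[].
  by rewrite mem_primes_upto => /andP[/prime_gt0].
have xs : (x ^ size s <= (\prod_(p <- s) p) ^ 2)%N.
  have : all (fun p => x <= p ^ 2)%N s.
    by apply/allP => p; rewrite mem_filter mem_large_primes => /and4P[_ _ _ /ltnW].
  elim: s {sF} => [|p s IH] /=; first by rewrite big_nil.
  by case/andP=> xp /IH h; rewrite big_cons expnS expnMn leq_mul.
have : (x ^ (size s * q.-1) <= (q * q.+1) ^ (2 * x))%N.
  rewrite expnM (leq_trans (_ : _ <= ((\prod_(p <- s) p) ^ 2) ^ q.-1)%N) //.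
    by case: q.-1 => // k; rewrite leq_exp2r.
  have swap A k : ((A ^ 2) ^ k = (A ^ k) ^ 2)%N by rewrite -!expnM mulnC.
  rewrite swap expnM swap leq_exp2r //.
  apply: leq_trans (prod_primes_1mod_le x qp).
  by case: q.-1 => // k; rewrite leq_exp2r.
move/(@ln_natX_le R _ _ _ _ x0); rewrite muln_gt0 q0 => /(_ isT).
rewrite -size_filter -/s !natrM -subn1 natrB //.
by rewrite mulrAC.
Qed.

(** The majorant imitates (2 ln q + 2) / q, the integral of 2 ln t / t^2 from q to infinity.
    Clearing denominators leaves q (ln (q + 1) - ln q) <= 1 and the monotonicity of ln. *)
Lemma ln_quot_telescope (R : realType) (q : nat) : (2 <= q)%N ->
  ln (q * q.+1)%:R / (q%:R * (q%:R - 1)) <=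
  (2 * ln (q%:R) + 2) / (q%:R - 1) - (2 * ln q.+1%:R + 2) / q%:R :> R.
Proof.
move=> q2; have Q2 : 2 <= q%:R :> R by rewrite ler_nat.
have q0 : 0 < q%:R :> R by lra.
have q10 : 0 < q%:R - 1 :> R by lra.
rewrite natrM lnM ?posrE ?ltr0n //; last by lia.
set u := ln q%:R; set v := ln q.+1%:R.
have uv : q%:R * (v - u) <= 1.
  rewrite /u /v -ln_div ?posrE ?ltr0n //; last by lia.
  have -> : q.+1%:R / q%:R = 1 + q%:R^-1 :> R by rewrite -natr1; field; lra.
  have h : ln (1 + q%:R^-1) <= q%:R^-1 :> R.
    by apply: le_ln1Dx; rewrite (lt_trans (_ : -1 < 0)) ?invr_gt0 //; lra.
  by rewrite (le_trans (ler_wpM2l (ltW q0) h)) // mulfV ?gt_eqF.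
have uv' : u <= v by rewrite /u /v ler_ln ?posrE ?ltr0n ?ler_nat //; lia.
rewrite -subr_ge0.
have -> : (2 * u + 2) / (q%:R - 1) - (2 * v + 2) / q%:R - (u + v) / (q%:R * (q%:R - 1)) =
  (2 * v + 2 - 2 * (q%:R * (v - u)) - (u + v)) / (q%:R * (q%:R - 1)).
  by field; rewrite !gt_eqF.
by rewrite divr_ge0 // ?mulr_ge0 ?(ltW q0) ?(ltW q10) //; lra.
Qed.

Lemma sum_ln_quot_le (R : realType) (x : nat) :
  \sum_(q <- primes_upto x) ln (q * q.+1)%:R / (q%:R * (q%:R - 1)) <= 2 * ln 2 + 2 :> R.
Proof.
(* The values at 0 and 1 repeat the one at 2, so the telescoping sum can start at 0. *)
pose G (q : nat) : R := if (q <= 1)%N then 2 * ln 2 + 2 else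
  (2 * ln q%:R + 2) / (q%:R - 1).
have G0 q : 0 <= G q.
  rewrite /G; case: leqP => h; first by rewrite addr_ge0 // mulr_ge0 // (ln_nat_ge0 R 2).
  apply: divr_ge0; last by rewrite subr_ge0 ler1n ltnW.
  by rewrite addr_ge0 // mulr_ge0 // ln_nat_ge0.
apply: le_trans (_ : \sum_(0 <= q < x.+1) (G q - G q.+1) <= _); last first.
  rewrite -(opprK (\sum_(_ <= _ < _) _)) -sumrN.
  under eq_bigr do rewrite opprB.
  rewrite telescope_sumr // opprB {1}/G /= lerBlDr lerDl; exact: G0.
rewrite big_filter big_mkcond /= /index_iota subn0; apply: ler_sum => q _.
have tele k : (2 <= k)%N ->
    0 <= ln ((k * k.+1)%:R : R) / (k%:R * (k%:R - 1)) <= G k - G k.+1.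
  move=> k2; rewrite divr_ge0 ?ln_nat_ge0 //=; last first.
    by rewrite mulr_ge0 // subr_ge0 ler1n ltnW.
  apply: le_trans (ln_quot_telescope R k2) _.
  have k1 : k.+1%:R - 1 = k%:R :> R by rewrite -natr1 addrK.
  by rewrite /G leqNgt k2 /= ltnNge (ltnW k2) /= k1.
case: ifP => [qp|_]; first by have /andP[] := tele q (prime_gt1 qp).
case: q => [|[|q]]; first by rewrite /G /= subrr.
  by rewrite /G /= (_ : 2%:R - 1 = 1) ?divr1 ?subrr //; lra.
by have /andP[h1 h2] := tele q.+2 isT; apply: le_trans h2.
Qed.

(** * The totient of p - 1 on average *)

Definition prime_recip_sum (R : realType) (m : nat) : R :=
  \sum_(q <- primes m) q%:R^-1.

(** Factor by factor, (1 - 1/q) exp (2/q) >= (1 - 1/q) (1 + 2/q) >= 1 for q >= 2. *)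
Lemma totient_ge_expR (R : realType) (m : nat) : (0 < m)%N ->
  m%:R * expR (- (2 * prime_recip_sum R m)) <= (totient m)%:R.
Proof.
move=> m0; rewrite totientE // {1}(prod_prime_decomp m0) prime_decompE big_map /=.
rewrite /prime_recip_sum mulr_sumr -sumrN expR_sum !natr_prod -big_split /=.
rewrite big_seq [leRHS]big_seq; apply: ler_prod => q.
rewrite mem_primes => /and3P[qp _ qm].
have q2 : 2 <= q%:R :> R by rewrite ler_nat prime_gt1.
have q0 : 0 < q%:R :> R by lra.
rewrite mulr_ge0 ?expR_ge0 //=.
have l0 : (0 < logn q m)%N by rewrite logn_gt0 mem_primes qp m0.
rewrite -{1}(prednK l0) expnS !natrM mulrAC ler_wpM2r //.
have qP : q.-1%:R = q%:R - 1 :> R by rewrite -subn1 natrB ?prime_gt0.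
rewrite qP expRN ler_pdivrMr ?expR_gt0 //.
have := expR_ge1Dx (2 * q%:R^-1 : R).
have iq : q%:R * q%:R^-1 = 1 :> R by rewrite mulfV ?gt_eqF.
have i0 : 0 < q%:R^-1 :> R by rewrite invr_gt0.
move: (expR _) => E; move: (q%:R^-1) iq i0 => z iq i0 hE.
apply: le_trans (_ : (q%:R - 1) * (1 + 2 * z) <= _); first nra.
by rewrite ler_wpM2l //; lra.
Qed.

(** After exchange of the sums, q has weight 1/q times the number of p with q dividing p - 1; the
    bound for that number leaves the convergent series of [sum_ln_quot_le]. *)
Lemma sum_prime_recip_le (R : realType) (x : nat) : (2 <= x)%N ->
  (\sum_(p <- large_primes x) prime_recip_sum R p.-1) * ln x%:R
    <= 2 * x%:R * (2 * ln 2 + 2).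
Proof.
move=> x2; have x0 : (0 < x)%N by lia.
have -> : \sum_(p <- large_primes x) prime_recip_sum R p.-1 =
  \sum_(q <- primes_upto x) q%:R^-1 * (count (fun p => q %| p.-1)%N (large_primes x))%:R.
  transitivity (\sum_(p <- large_primes x) \sum_(q <- primes_upto x | (q %| p.-1)%N) q%:R^-1 : R).
    rewrite big_seq [RHS]big_seq; apply: eq_bigr => p.
    rewrite mem_large_primes => /and3P[pp px _]; rewrite -[RHS]big_filter.
    apply: perm_big; apply: uniq_perm.
    - exact: primes_uniq.
    - by rewrite !filter_uniq ?iota_uniq.
    have p1 := prime_gt1 pp.
    have p10 : (0 < p.-1)%N by rewrite -ltnS prednK // prime_gt0.
    move=> q; rewrite mem_primes mem_filter mem_primes_upto p10 /=.
    case: (prime q); rewrite ?andbF //=; case: (boolP (q %| _)%N) => //= /dvdn_leq.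
    by move/(_ p10) => h; rewrite (leq_trans h) // (leq_trans (leq_pred _)).
  rewrite (exchange_big_dep predT) //=; apply: eq_bigr => q _.
  by rewrite -big_filter big_const_seq count_predT iter_addr_0 size_filter mulr_natr.
rewrite mulr_suml.
apply: le_trans (_ : \sum_(q <- primes_upto x) 2 * x%:R *
   (ln (q * q.+1)%:R / (q%:R * (q%:R - 1))) <= _); last first.
  by rewrite -mulr_sumr ler_wpM2l ?sum_ln_quot_le // mulr_ge0.
rewrite big_seq [leRHS]big_seq; apply: ler_sum => q.
rewrite mem_primes_upto => /andP[qp _].
have q2 : 2 <= q%:R :> R by rewrite ler_nat prime_gt1.
have q0 : 0 < q%:R :> R by lra.
have q10 : 0 < q%:R - 1 :> R by lra.
have h := count_1mod_large_primes R qp x0.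
rewrite mulrA ler_pdivlMr ?mulr_gt0 //.
apply: le_trans h; rewrite le_eqVlt; apply/orP; left; apply/eqP.
by field; rewrite gt_eqF.
Qed.

Lemma good_primes (R : realType) : exists2 c : R, 0 < c & exists x0 : nat,
  forall x, (x0 <= x)%N -> exists P : seq nat,
  [/\ uniq P,
      forall p, p \in P -> [/\ prime p, odd p, (p <= x)%N & c * p%:R <= (totient p.-1)%:R],
      forall p, p \in P -> (size P <= 2 * p)%N &
      c * x%:R <= (size P)%:R * ln (x%:R : R)].
Proof.
have [c1 c10 [x1 T1]] := size_large_primes_ge R.
have l2 : 0 < ln 2 :> R by rewrite ln_gt0 // ltr1n.
set g : R := 2 * ln 2 + 2; have g0 : 0 < g by rewrite /g; lra.
(* By Markov's inequality this threshold loses at most c1 x / (2 ln x) primes, half of the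
   guaranteed number. *)
set A : R := 4 * g / c1; have A0 : 0 < A by rewrite divr_gt0 // mulr_gt0.
set e := expR (- (2 * A)); have e0 : 0 < e := expR_gt0 _.
exists (Num.min (e / 2) (c1 / 4)); first by rewrite lt_min !divr_gt0.
exists (maxn x1 4) => x; rewrite geq_max => /andP[x1x x4].
have x2 : (2 <= x)%N by exact: leq_trans x4.
set T := large_primes x.
have uT : uniq T by rewrite !filter_uniq ?iota_uniq.
have L0 : 0 < ln x%:R :> R by rewrite ln_gt0 // ltr1n.
set P0 := [seq p <- T | prime_recip_sum R p.-1 <= A].
have sP0 : c1 / 2 * x%:R <= (size P0)%:R * ln (x%:R : R).
  have hT := T1 x x1x.
  have hS := @sum_prime_recip_le R x x2; rewrite -/T -/g in hS.
  set bad := count (predC (fun p => prime_recip_sum R p.-1 <= A)) T.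
  have hb : A * bad%:R <= \sum_(p <- T) prime_recip_sum R p.-1.
    rewrite /bad -sum1_count natr_sum [X in A * X]big_mkcond mulr_sumr /=; apply: ler_sum => p _.
    case: ifP => /= [|_]; first by rewrite -ltNge mulr1 => /ltW.
    by rewrite mulr0 sumr_ge0 // => q _; rewrite invr_ge0.
  have sT : (size T)%:R = (size P0)%:R + bad%:R :> R.
    by rewrite -(count_predC (fun p => prime_recip_sum R p.-1 <= A) T) natrD -size_filter.
  have hbad : bad%:R * ln x%:R <= c1 / 2 * x%:R.
    have h : A * bad%:R * ln x%:R <= 2 * x%:R * g.
      by apply: le_trans hS; rewrite ler_wpM2r // ltW.
    rewrite -(ler_pM2l A0) mulrA; apply: le_trans h _.
    by rewrite /A le_eqVlt; apply/orP; left; apply/eqP; field; rewrite gt_eqF.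
  by move: hT; rewrite sT; lra.
(* The cap |P| <= 2 p serves the first moment of Wieferich primes. The discarded primes are below
   |P0| / 2, so at least half of P0 stays. *)
set P := [seq p <- P0 | size P0 <= 2 * p]%N.
have uP0 : uniq P0 by rewrite filter_uniq.
have PT p : p \in P0 -> [/\ prime p, (p <= x)%N & (x < p ^ 2)%N].
  by rewrite mem_filter mem_large_primes => /and4P[_ -> -> ->].
have PP0 : (size P <= size P0)%N by rewrite size_filter count_size.
have P0P : (size P0 <= 2 * size P)%N.
  have rem : (size [seq p <- P0 | ~~ (size P0 <= 2 * p)] <= (size P0).-1./2)%N.
    rewrite -[leqRHS](size_iota 1); apply: uniq_leq_size; first by rewrite filter_uniq.
    move=> p; rewrite mem_filter mem_iota -ltnNge => /andP[h /PT[/prime_gt0 p0 _ _]].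
    by move: h p0; clear; lia.
  have E : (size P + size [seq p <- P0 | ~~ (size P0 <= 2 * p)] = size P0)%N.
    by rewrite /P !(size_filter _ P0); exact: count_predC.
  by move: rem E; clear; move: (size [seq _ <- _ | ~~ _]) => r; lia.
exists P; split; first by rewrite filter_uniq.
- move=> p; rewrite mem_filter => /andP[_ pP0]; have [pp px xp] := PT p pP0.
  have p2 : (2 < p)%N.
    rewrite ltnNge; apply/negP => h; have h2 : (p ^ 2 <= 2 ^ 2)%N by rewrite leq_exp2r.
    by have := leq_trans xp (leq_trans h2 x4); rewrite ltnn.
  split=> //; first by case: (even_prime pp) => // h; rewrite h in p2.
  have pA : prime_recip_sum R p.-1 <= A by move: pP0; rewrite mem_filter => /andP[].
  have p10 : (0 < p.-1)%N by rewrite -ltnS prednK ?(ltnW p2) // prime_gt0.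
  apply: le_trans (totient_ge_expR R p10).
  apply: le_trans (_ : e / 2 * p%:R <= _); first by rewrite ler_wpM2r // ge_min lexx.
  have he : e <= expR (- (2 * prime_recip_sum R p.-1)) by rewrite ler_expR lerN2 ler_wpM2l.
  have hp : p%:R <= 2 * p.-1%:R :> R by rewrite -natrM ler_nat; move: p2; clear; lia.
  by move: he hp; move: (expR _) => E he hp; have : 0 <= p.-1%:R :> R by []; nra.
- by move=> p; rewrite mem_filter => /andP[h _]; exact: leq_trans h.
apply: le_trans (_ : c1 / 4 * x%:R <= _); first by rewrite ler_wpM2r // ge_min lexx orbT.
have : (size P0)%:R <= 2 * (size P)%:R :> R by rewrite -natrM ler_nat.
move=> /(ler_wpM2r (ltW L0)); move: sP0; lra.
Qed.

(** * Counting *)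

Lemma padic_val_intr p (z : int) : z != 0 -> padic_val p z%:~R = (logn p `|z|)%:Z%:E.
Proof.
by move=> z0; rewrite /padic_val intr_eq0 (negbTE z0) numq_int denq_int logn1 subr0.
Qed.

Lemma witness_special_prime (a b : int) p : witness a b p -> special_prime a%:~R b%:~R p.
Proof.
case=> pp op /andP[pa pb] jp [k kP].
have nz (z : int) : ~~ (p %| `|z|)%N -> z != 0.
  by apply: contraNneq => ->; rewrite absz0 dvdn0.
have v0 (z : int) : ~~ (p %| `|z|)%N -> padic_val p z%:~R = 0%:E.
  by move=> h; rewrite padic_val_intr ?nz // logn_coprime // prime_coprime.
split=> //; first by rewrite !v0.
  exists k%:Z; rewrite -PoszM -exprnP -rmorphXn -rmorphB /=.
  have [->|z0] := eqVneq (a ^+ (2 * k) - b) 0.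
    by rewrite /padic_val eqxx leey.
  rewrite padic_val_intr // lee_fin lez_nat logn_gt0 mem_primes pp kP absz_gt0 z0.
  by [].
rewrite /legendre ratr_int Fp_intr_eq0 // (negbTE pa).
by move: jp; rewrite jacobi_sign_prime // => /negbTE ->.
Qed.

Lemma special_of_witness (a b : int) p : (1 < `|a|)%N -> (1 < `|b|)%N ->
  witness a b p -> ~~ (p ^ 2 %| `|a| ^ p.-1 - 1)%N -> special a%:~R b%:~R.
Proof.
move=> a1 b1 wp nW.
have nu (z : int) : (1 < `|z|)%N -> (z%:~R : rat) \notin [:: 0; 1; -1].
  move=> z1; rewrite !inE -[-1]/((-1)%:~R) -[1]/(1%:~R) -[0]/(0%:~R) !eqr_int.
  by apply/negP => /or3P[]/eqP zE; rewrite zE in z1.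
split; [exact: nu|exact: nu|move=> fin].
have b0 : b != 0 by apply: contraTneq b1 => ->.
have [q qB wq] := witness_unbounded a1 b0 wp nW
  (\max_(x <- fset_set [set p | special_prime a%:~R b%:~R p]) x).
have : q \in fset_set [set p | special_prime a%:~R b%:~R p].
  by rewrite in_fset_set // inE /=; exact: witness_special_prime.
move=> qS; move: qB; rewrite ltnNge => /negP; apply.
exact: (@leq_bigmax_seq _ _ xpredT id).
Qed.

(** * Counting the bases for which p is a Wieferich prime *)

Definition wieferich (p : nat) (a : int) : bool :=
  ~~ (p %| `|a|)%N && (p ^ 2 %| `|a| ^ p.-1 - 1)%N.

Lemma wieferich_expz p (a : int) : odd p -> wieferich p a ->
  ((p ^ 2)%N%:Z %| a ^+ p - a)%Z.
Proof.
move=> op /andP[pa pW]; have p0 : (0 < p)%N by case: (p) op.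
have a0 : (0 < `|a|)%N by rewrite lt0n; apply: contraNneq pa => ->; rewrite dvdn0.
have -> : a ^+ p - a = a * (`|a| ^ p.-1 - 1)%N%:Z.
  have pE : p = (p.-1./2 * 2).+1 by move: op; clear; lia.
  rewrite -subzn ?expn_gt0 ?a0 // mulrBr mulr1 {1}pE exprS; congr (_ * _ - _).
  rewrite -[in RHS]natz natrX natz {2}pE /= mulnC !exprM abszE.
  by rewrite real_normK ?num_real.
by rewrite dvdz_mull.
Qed.

(** The cofactor of a - b is a sum of p terms, all congruent to b^(p-1) modulo p. *)
Lemma dvdz_expz_sub p (a b : int) : prime p -> (p%:Z %| a - b)%Z ->
  ((p ^ 2)%N%:Z %| a ^+ p - b ^+ p)%Z.
Proof.
move=> pp ab; rewrite subrXX expnS expn1 PoszM; apply: dvdz_mul => //.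
have abF : a%:~R = b%:~R :> 'F_p.
  by apply/eqP; rewrite -subr_eq0 -rmorphB /= Fp_intr_eq0.
rewrite -[(_ %| _)%Z]/(_ %| _)%N -Fp_intr_eq0 // rmorph_sum /=.
under eq_bigr => i _ do rewrite rmorphM !rmorphXn /= abF -exprD.
rewrite (eq_bigr (fun=> b%:~R ^+ p.-1)); last by move=> i _; congr (_ ^+ _); have := ltn_ord i; lia.
by rewrite sumr_const card_ord -mulr_natr pchar_Fp_0 // mulr0.
Qed.

(** Such a base satisfies a = a^p modulo p^2, and a^p modulo p^2 depends only on a modulo p. So i is
    determined by i modulo p and the quotient of i by p^2. *)
Lemma count_wieferich p N : prime p -> odd p ->
  (count (fun i : nat => wieferich p (i%:Z - N%:Z)) (iota 0 (2 * N).+1)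
   <= p * (2 * N %/ p ^ 2).+1)%N.
Proof.
move=> pp op; have p0 := prime_gt0 pp; have p20 : (0 < p ^ 2)%N by rewrite expn_gt0 p0.
rewrite -size_filter; set s := [seq i <- _ | _].
pose f (i : nat) := ((i %% p)%N, (i %/ p ^ 2)%N).
have inj : {in s &, injective f}.
  move=> i i'; rewrite !mem_filter => /andP[wi _] /andP[wi' _] [E1 E2].
  have /eqP E3 : i == i' %[mod p ^ 2].
    have : ((p ^ 2)%N%:Z %| i%:Z - i'%:Z)%Z.
      have h1 := wieferich_expz op wi; have h2 := wieferich_expz op wi'.
      have h3 : ((p ^ 2)%N%:Z %| (i%:Z - N%:Z) ^+ p - (i'%:Z - N%:Z) ^+ p)%Z.
        apply: dvdz_expz_sub => //; rewrite opprB addrA subrK.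
        by rewrite -eqz_mod_dvd !modz_nat eqz_nat; apply/eqP.
      set A := i%:Z - N%:Z in h1 h3; set B := i'%:Z - N%:Z in h2 h3.
      have -> : i%:Z - i'%:Z = (A ^+ p - B ^+ p) - (A ^+ p - A) + (B ^+ p - B).
        by rewrite /A /B; ring.
      by rewrite rpredD // rpredB.
    by rewrite -eqz_mod_dvd !modz_nat eqz_nat.
  by rewrite (divn_eq i (p ^ 2)) E2 E3 -divn_eq.
have : (size (map f s) <= size [seq (x, y) | x <- iota 0 p, y <- iota 0 (2 * N %/ p ^ 2).+1])%N.
  apply: uniq_leq_size; first by rewrite map_inj_in_uniq // filter_uniq ?iota_uniq.
  move=> _ /mapP[i iS ->]; move: iS; rewrite mem_filter mem_iota => /andP[_ iN].
  rewrite allpairs_f // mem_iota /= add0n ?ltn_pmod //.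
  by rewrite ltnS leq_div2r.
by rewrite size_map size_allpairs !size_iota.
Qed.

(** * Generators and squares modulo p *)

Definition Fp_generator p : pred 'F_p := fun r => p.-1.-primitive_root r.

Definition Fp_square p : pred 'F_p :=
  fun r => (r != 0) && [exists y : 'F_p, y ^+ 2 == r].

Lemma card_Fp_generator p : prime p -> (totient p.-1 <= #|@Fp_generator p|)%N.
Proof.
move=> pp; have p1 := prime_gt1 pp; have [g gp] := Fp_prim_root pp.
have -> : totient p.-1 = size [seq g ^+ k | k <- iota 0 p.-1 & coprime k p.-1].
  rewrite size_map size_filter totient_count_coprime -sum1_count [RHS]big_mkcond /=.
  by rewrite /index_iota subn0; apply: eq_bigr => k _; rewrite coprime_sym; case: coprime.
rewrite -(card_uniqP _); last first.
  rewrite map_inj_in_uniq ?filter_uniq ?iota_uniq // => i j.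
  rewrite !mem_filter !mem_iota !add0n => /and3P[_ _ hi] /and3P[_ _ hj] /eqP.
  by rewrite (eq_prim_root_expr gp) !modn_small // => /eqP.
apply: subset_leq_card; apply/fintype.subsetP => r /mapP[i]; rewrite mem_filter => /andP[ci _] ->.
by rewrite unfold_in /Fp_generator (prim_root_exp_coprime _ gp).
Qed.

Lemma card_Fp_square p : prime p -> odd p -> (p./2 <= #|@Fp_square p|)%N.
Proof.
move=> pp op; have [g gp] := Fp_prim_root pp.
have g0 : g != 0.
  have := prim_expr_order gp; apply: contra_eq_neq => ->.
  have p10 : (0 < p.-1)%N by have := prime_gt1 pp; lia.
  by rewrite expr0n gtn_eqF // eq_sym oner_neq0.
rewrite -[leqLHS](size_iota 0) -(size_map (fun i => g ^+ (2 * i))).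
rewrite -(card_uniqP _); last first.
  rewrite map_inj_in_uniq ?iota_uniq // => i j; rewrite !mem_iota /= !add0n => hi hj /eqP.
  rewrite (eq_prim_root_expr gp) !modn_small; first by move/eqP; lia.
  - by have := odd_double_half p; rewrite op; lia.
  - by have := odd_double_half p; rewrite op; lia.
apply: subset_leq_card; apply/fintype.subsetP => r /mapP[i _ ->].
rewrite unfold_in /Fp_square expf_neq0 //=; apply/existsP; exists (g ^+ i).
by rewrite mulnC exprM.
Qed.

(** A generator is a nonresidue, and b = y^2 with y = a^i gives b = a^(2i) modulo p, so p is a
    witness. *)
Lemma special_of_residues (a b : int) p : prime p -> odd p ->
  (1 < `|a|)%N -> (1 < `|b|)%N ->
  @Fp_generator p a%:~R -> ~~ wieferich p a -> @Fp_square p b%:~R ->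
  special a%:~R b%:~R.
Proof.
move=> pp op a1 b1 ga nW /andP[bF0 /existsP[y /eqP yb]].
have p1 := prime_gt1 pp.
have p10 : (0 < p.-1)%N by rewrite -ltnS prednK // ltnW.
have aF0 : (a%:~R : 'F_p) != 0.
  have := prim_expr_order ga; apply: contra_eq_neq => ->.
  by rewrite expr0n gtn_eqF // eq_sym oner_neq0.
have pa : ~~ (p %| `|a|)%N by rewrite -Fp_intr_eq0.
have pb : ~~ (p %| `|b|)%N by rewrite -Fp_intr_eq0.
apply: (special_of_witness (p := p)) => //; last first.
  by move: nW; rewrite /wieferich pa.
have y0 : y != 0 by apply: contraNneq bF0 => y0; rewrite -yb y0 expr0n.
have [i yE] := prim_root_Fp pp ga y0.
split; rewrite ?pa ?pb //.
  rewrite jacobi_sign_prime //; apply/existsPn => z; apply/negP => /eqP za.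
  have : (a%:~R : 'F_p) ^+ p./2 == 1.
    by rewrite euler_criterion //; apply/existsP; exists z; rewrite za.
  rewrite -(prim_order_dvd ga) => /dvdn_leq.
  by have := odd_double_half p; rewrite op; lia.
exists i; rewrite -Fp_intr_eq0 // rmorphB rmorphXn /=.
by rewrite mulnC exprM -yE yb subrr.
Qed.

(** * Summation over a and b *)

Lemma natr_count (R : pzSemiRingType) (T : Type) (a : pred T) (s : seq T) :
  (count a s)%:R = \sum_(x <- s) (a x)%:R :> R.
Proof.
rewrite -sum1_count natr_sum big_mkcond /=.
by apply: eq_bigr => x _; case: (a x).
Qed.

(** Each p contributes at most 2 N / p + p. Multiplied by |P| <= 2 p this is at most 4 N + 2 p^2 <=
    4 N + 128 N, whence the 132. *)
Lemma sum_count_wieferich (R : realType) (P : seq nat) (N Q : nat) :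
  (Q ^ 2 <= 64 * N)%N ->
  (forall p, p \in P -> [/\ prime p, odd p, (p <= Q)%N & (size P <= 2 * p)%N]) ->
  \sum_(i <- iota 0 (2 * N).+1)
     (count (fun p => wieferich p (i%:Z - N%:Z)) P)%:R <= 132 * N%:R :> R.
Proof.
move=> QN PQ; under eq_bigr do rewrite natr_count.
rewrite exchange_big /=.
apply: le_trans (_ : \sum_(p <- P) 132 * N%:R / (size P)%:R <= _); last first.
  rewrite big_const_seq count_predT iter_addr_0 -[leLHS]mulr_natr.
  case: (size P) => [|k]; first by rewrite mulr0 mulr_ge0.
  by rewrite divfK.
rewrite big_seq [leRHS]big_seq; apply: ler_sum => p pP.
have [pp op pQ sp] := PQ p pP; have p0 := prime_gt0 pp.
rewrite -natr_count; apply: le_trans (_ : (p * (2 * N %/ p ^ 2).+1)%:R <= _).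
  by rewrite ler_nat count_wieferich.
have s0 : (0 < size P)%N by case: (P) pP.
rewrite ler_pdivlMr ?ltr0n // -!natrM ler_nat.
have pN : (p * p <= 64 * N)%N.
  by apply: leq_trans QN; rewrite expnS expn1 leq_mul.
have dN : (2 * N %/ p ^ 2 * (p * p) <= 2 * N)%N.
  by rewrite -[(p * p)%N]/(p ^ 2)%N leq_divM.
move: dN pN sp p0; move: (size P) (2 * N %/ p ^ 2)%N; clear => s d dN pN sp p0.
apply: leq_trans (_ : p * d.+1 * (2 * p) <= _)%N; first by rewrite leq_mul2l sp orbT.
nia.
Qed.

(* The index i in [0, 2N] stands for the integer i - N. *)
Definition nonspecial_index (N i j : nat) : bool :=
  `[< [/\ (1 < `|i%:Z - N%:Z|)%N, (1 < `|j%:Z - N%:Z|)%N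
     & ~ special (i%:Z - N%:Z)%:~R (j%:Z - N%:Z)%:~R] >].

(** More than c |P| / 4 primes of P have a as a generator and are not Wieferich for a; a nonspecial
    b is a nonzero square modulo none of them. Squares have density at least 1/4, so the sieve gives
    256 Q^2, and 4 * 256 = 32^2. *)
Lemma count_nonspecial_fiber (R : realType) (P : seq nat) (N Q i : nat) (c : R) :
  uniq P -> (forall p, p \in P -> [/\ prime p, odd p & (p <= Q)%N]) ->
  (0 < N)%N -> (16 * N <= Q ^ 2)%N -> (0 < size P)%N -> 0 < c ->
  c / 2 * (size P)%:R < (count (fun p => @Fp_generator p (i%:R - N%:R)) P)%:R ->
  (count (fun p => wieferich p (i%:Z - N%:Z)) P)%:R <= c / 4 * (size P)%:R ->
  (count (nonspecial_index N i) (iota 0 (2 * N).+1))%:R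
   * (c * (size P)%:R) <= 32 ^+ 2 * (Q ^ 2)%:R.
Proof.
move=> uP PQ N0 NQ sP0 c0 hg hw.
set a := i%:Z - N%:Z in hw *.
have valF p (j : nat) : (j%:Z - N%:Z)%:~R = j%:R - N%:R :> 'F_p.
  by rewrite rmorphB /= -!pmulrn.
set Pi := [seq p <- P | @Fp_generator p (i%:R - N%:R) && ~~ wieferich p a].
have uPi : uniq Pi by rewrite filter_uniq.
have sPi : c / 4 * (size P)%:R <= (size Pi)%:R :> R.
  have : (count (fun p => @Fp_generator p (i%:R - N%:R)) P)%:R <=
     (size Pi)%:R + (count (fun p => wieferich p a) P)%:R :> R.
    rewrite /Pi size_filter !natr_count -big_split /=; apply: ler_sum => p _.
    by case: Fp_generator; case: wieferich; rewrite /= ?addr0 ?add0r.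
  by move: hg hw; lra.
have sPi0 : 0 < (size Pi)%:R :> R.
  by apply: lt_le_trans sPi; rewrite mulr_gt0 ?divr_gt0 ?ltr0n.
pose few (j : nat) := (count (fun p => @Fp_square p (j%:R - N%:R)) Pi)%:R
    <= 1 / 4 / 2 * (size Pi)%:R :> R.
have LS : (count few (iota 0 (2 * N).+1))%:R * ((1 / 4) ^+ 2 * (size Pi)%:R)
    <= 16 * (Q ^ 2)%:R :> R.
  apply: (@large_sieve_count R Pi N Q Fp_square) => //.
    by move=> p; rewrite mem_filter => /andP[_ /PQ[-> _ ->]].
  move=> p; rewrite mem_filter => /andP[_ /PQ[pp op _]].
  apply: le_trans (_ : (p./2)%:R <= _); last by rewrite ler_nat card_Fp_square.
  have : (p <= 4 * p./2)%N.
    by move: op (prime_gt1 pp); clear; lia.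
  by rewrite -(ler_nat R) natrM; lra.
set bad := nonspecial_index N i.
have badS j : bad j -> few j.
  move=> /asboolP[a1 b1 nsp]; rewrite /few leNgt; apply/negP => h.
  have : has (fun p => @Fp_square p (j%:R - N%:R)) Pi.
    rewrite has_count lt0n; apply: contraTneq h => ->.
    by rewrite -leNgt mulr_ge0 ?divr_ge0.
  case/hasP => p; rewrite mem_filter => /andP[/andP[ga nW] /PQ[pp op _]] sb.
  by apply: nsp; apply: (special_of_residues pp op); rewrite // valF.
have cb : (count bad (iota 0 (2 * N).+1))%:R <=
    (count few (iota 0 (2 * N).+1))%:R :> R.
  by rewrite ler_nat; apply: sub_count => j /badS.
move: LS cb; set B : R := (count bad _)%:R; set X : R := (count _ _)%:R => LS cb.
have B0 : 0 <= B by rewrite /B.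
have h1 : B * (c / 4 * (size P)%:R) <= X * (size Pi)%:R.
  by apply: ler_pM => //; rewrite mulr_ge0 // divr_ge0 // ltW.
have : X * (size Pi)%:R <= 256 * (Q ^ 2)%:R by move: LS; rewrite expr2; lra.
by rewrite [32 ^+ 2]expr2; move: h1; lra.
Qed.

(** With K = |P|, the O(N / K) rows with few generators or many Wieferich primes are bounded
    trivially, and every other row by O(N / K). The total O(N^2 / K) is then compared with K >> Q /
    ln Q for Q of order sqrt N. *)
Lemma sum_nonspecial_index_le (R : realType) : exists2 C : R, 0 < C &
  exists N0 : nat, forall N, (N0 <= N)%N ->
    \sum_(i <- iota 0 (2 * N).+1)
       (count (nonspecial_index N i) (iota 0 (2 * N).+1))%:R
    <= C * (N%:R * Num.sqrt N%:R) * ln (N%:R : R).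
Proof.
have [c c0 [x0 good]] := good_primes R.
(* Abstract constants, because numerals are unary and costly to compute with. *)
have [kg [kgE kg0]] : exists kg : R, kg = 16 * 64 /\ 0 < kg.
  by exists (16 * 64); rewrite mulr_gt0.
have [kw [kwE kw0]] : exists kw : R, kw = 4 * 132 /\ 0 < kw.
  by exists (4 * 132); rewrite mulr_gt0.
have [ke [keE ke0]] : exists ke : R, ke = 32 ^+ 2 /\ 0 < ke.
  by exists (32 ^+ 2); rewrite exprn_gt0.
have [D DE] : exists D, D = 3 * (kg / c ^+ 2 + (kw + ke * 64) / c) by eexists.
have D0 : 0 < D.
  by rewrite DE mulr_gt0 // addr_gt0 ?divr_gt0 ?exprn_gt0 // addr_gt0 ?mulr_gt0.
exists (D / c); first by rewrite divr_gt0.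
(* From 64 on, Q <= N and hence ln Q <= ln N; the square of x0 ensures Q >= x0. *)
exists (maxn 64 (x0 ^ 2)) => N; rewrite geq_max => /andP[N64 Nx0].
(* Q = m + 1 satisfies 16 N < Q^2 <= 4 m^2 <= 64 N: the lower bound is for the sieve, the upper one
   for the Wieferich count. *)
have [m /andP[mN Nm]] := sqrt_nat_exists (16 * N).
set Q := m.+1 in Nm; have N0 : (0 < N)%N := leq_trans (isT : 0 < 64)%N N64.
have NQ : (16 * N <= Q ^ 2)%N := ltnW Nm.
have QN : (Q ^ 2 <= 64 * N)%N.
  have m0 : (0 < m)%N.
    by case: m @Q mN Nm NQ => // Q _; rewrite exp1n; move: N64; clear; lia.
  have : (Q ^ 2 <= 4 * m ^ 2)%N by rewrite /Q !expnS !expn0; move: m0; clear; nia.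
  by move: mN; clear; lia.
have Qx0 : (x0 <= Q)%N.
  rewrite -(@leq_exp2r _ _ 2) // (leq_trans Nx0) // (leq_trans _ NQ) //.
  by rewrite leq_pmull.
have QleN : (Q <= N)%N.
  rewrite -(@leq_exp2r _ _ 2) // (leq_trans QN) // expnS expn1.
  by rewrite leq_mul2r N64 orbT.
have [P [uP PP sP KQ]] := good Q Qx0.
set K := size P in sP KQ.
have Q0 : 0 < Q%:R :> R by rewrite ltr0n.
have Nr : 0 < N%:R :> R by rewrite ltr0n.
have K0 : (0 < K)%N.
  rewrite lt0n; apply: contraTneq KQ => ->.
  by rewrite mul0r -ltNge mulr_gt0.
have Kr : 0 < K%:R :> R by rewrite ltr0n.
set I := iota 0 (2 * N).+1.
pose gb (i : nat) := (count (fun p => @Fp_generator p (i%:R - N%:R)) P)%:R <= c / 2 * K%:R.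
pose W (i : nat) : R := (count (fun p => wieferich p (i%:Z - N%:Z)) P)%:R.
pose wb (i : nat) := c / 4 * K%:R < W i.
have LSg : (count gb I)%:R * (c ^+ 2 * K%:R) <= 16 * (Q ^ 2)%:R.
  apply: (@large_sieve_count R P N Q Fp_generator) => //.
    by move=> p /PP[-> _ ->].
  move=> p /PP[pp _ _ h]; apply: le_trans h _.
  by rewrite ler_nat card_Fp_generator.
have LSw : (count wb I)%:R * (c / 4 * K%:R) <= 132 * N%:R.
  have h := @sum_count_wieferich R P N Q QN.
  apply: le_trans (h _) => [|p pP]; last by have [-> -> ->] := PP p pP; rewrite sP.
  rewrite natr_count mulr_suml; apply: ler_sum => i _.
  by case: (boolP (wb i)) => [/ltW|_]; rewrite ?mul1r // mul0r.
have [E EE] : exists E : R, E = ke * (Q ^ 2)%:R / (c * K%:R) by eexists.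
have cK0 : 0 < c * K%:R by rewrite mulr_gt0.
have E0 : 0 <= E by rewrite EE divr_ge0 ?(ltW cK0) // mulr_ge0 // ltW.
have fiber i : (count (nonspecial_index N i) I)%:R <=
    (2 * N).+1%:R * (gb i)%:R + (2 * N).+1%:R * (wb i)%:R + E.
  have triv : (count (nonspecial_index N i) I)%:R <= (2 * N).+1%:R :> R.
    by rewrite ler_nat (leq_trans (count_size _ _)) // size_iota.
  have M0 : 0 <= (2 * N).+1%:R :> R by [].
  case: (boolP (gb i)) => gi; first by case: (wb i); rewrite ?mulr1 ?mulr0; lra.
  case: (boolP (wb i)) => wi; first by rewrite ?mulr1 ?mulr0; lra.
  rewrite !mulr0 !add0r EE ler_pdivlMr // keE.
  apply: (@count_nonspecial_fiber R P N Q i c) => //.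
  - by move=> p /PP[-> -> ->].
  - by rewrite ltNge.
  - by rewrite leNgt.
apply: le_trans (ler_sum _ (fun i _ => fiber i)) _.
rewrite !big_split /= -!mulr_sumr -!natr_count.
rewrite big_const_seq count_predT iter_addr_0 size_iota -[E *+ _]mulr_natr.
have N3 : (2 * N).+1%:R <= 3 * N%:R :> R by rewrite -natrM ler_nat; move: N0; clear; lia.
have QN' : (Q ^ 2)%:R <= 64 * N%:R :> R by rewrite -natrM ler_nat.
have g1 : (count gb I)%:R <= kg * N%:R / (c ^+ 2 * K%:R).
  rewrite ler_pdivlMr ?mulr_gt0 ?exprn_gt0 //; apply: le_trans LSg _; rewrite kgE; lra.
have w1 : (count wb I)%:R <= kw * N%:R / (c * K%:R).
  by rewrite ler_pdivlMr // kwE; move: LSw; lra.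
have e1 : E <= ke * (64 * N%:R) / (c * K%:R).
  by rewrite EE ler_pM2r ?invr_gt0 // ler_pM2l.
apply: le_trans (_ : 3 * N%:R * (kg * N%:R / (c ^+ 2 * K%:R) +
    kw * N%:R / (c * K%:R) + ke * (64 * N%:R) / (c * K%:R)) <= _).
  rewrite [E * _]mulrC -!mulrDr; apply: ler_pM => //; last by rewrite !lerD.
  by rewrite !addr_ge0.
have -> : 3 * N%:R * (kg * N%:R / (c ^+ 2 * K%:R) +
    kw * N%:R / (c * K%:R) + ke * (64 * N%:R) / (c * K%:R)) = D * (N%:R ^+ 2 / K%:R).
  by rewrite DE; field; rewrite !gt_eqF.
rewrite -!mulrA ler_pM2l //.
rewrite [leRHS](_ : _ = N%:R * (Num.sqrt N%:R * ln N%:R) / c); last by rewrite mulrC.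
rewrite mulrA ler_pdivrMr // [leRHS]mulrAC ler_pdivlMr //.
have sN : 0 < Num.sqrt N%:R :> R by rewrite sqrtr_gt0.
have sE : Num.sqrt N%:R ^+ 2 = N%:R :> R by rewrite sqr_sqrtr ?(ltW Nr).
have sQ : Num.sqrt N%:R <= Q%:R :> R.
  rewrite -ler_sqr ?nnegrE ?(ltW sN) ?(ltW Q0) // sE -natrX ler_nat.
  by rewrite (leq_trans _ NQ) // leq_pmull.
have lQ : ln Q%:R <= ln N%:R :> R by rewrite ler_ln ?posrE // ler_nat.
have l0 : 0 <= ln N%:R :> R := ln_nat_ge0 R N.
have KN : c * Num.sqrt N%:R <= K%:R * ln N%:R.
  apply: le_trans (_ : c * Q%:R <= _); first by rewrite ler_pM2l.
  by apply: le_trans KQ _; rewrite ler_wpM2l // ltW.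
have := ler_wpM2l (ltW (mulr_gt0 Nr sN)) KN.
set s := Num.sqrt _ in sE *; set l := ln _.
rewrite (_ : _ * (c * s) = N%:R * s ^+ 2 * c); last by ring.
by rewrite sE (_ : _ * (_ * l) = N%:R * (s * l) * K%:R) //; ring.
Qed.

Lemma card_nonspecial_pairs_le (n : nat) :
  (#|` fset_set (nonspecial_pairs n%:Z)|
   <= \sum_(i <- iota 0 (2 * n).+1) count (nonspecial_index n i) (iota 0 (2 * n).+1))%N.
Proof.
have [I IE] : exists I, I = iota 0 (2 * n).+1 by eexists.
rewrite -IE.
pose f (ab : int * int) := (`|(ab.1 + n%:Z)%R|%N, `|(ab.2 + n%:Z)%R|%N).
have shift (a : int) : `|a| <= n%:Z -> `|(a + n%:Z)%R|%N%:Z - n%:Z = a by lia.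
have shiftI (a : int) : `|a| <= n%:Z -> `|(a + n%:Z)%R|%N \in I.
  by rewrite IE mem_iota; lia.
have SE ab : ab \in fset_set (nonspecial_pairs n%:Z) ->
    [/\ (1 < `|ab.1| <= n%:Z), (1 < `|ab.2| <= n%:Z)
      & ~ special ab.1%:~R ab.2%:~R].
  by rewrite in_fset_set ?inE //; exact: finite_nonspecial_pairs.
have -> : (\sum_(i <- I) count (nonspecial_index n i) I)%N =
    size [seq (i, j) | i <- I, j <- [seq j <- I | nonspecial_index n i j]].
  rewrite size_allpairs_dep sumnE big_map.
  by apply: eq_bigr => i _; rewrite size_filter.
rewrite -(size_map f); apply: uniq_leq_size.
  rewrite map_inj_in_uniq ?fset_uniq // => -[a b] [a' b'] /SE[/= /andP[_ a1] /andP[_ b1] _].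
  move=> /SE[/= /andP[_ a2] /andP[_ b2] _] [E1 E2].
  by rewrite -(shift a a1) -(shift b b1) E1 E2 !shift.
move=> _ /mapP[[a b] /SE abS ->]; have [/= /andP[a0 a1] /andP[b0 b1] ns] := abS.
apply/allpairsPdep; exists `|(a + n%:Z)%R|%N, `|(b + n%:Z)%R|%N; split=> //.
  exact: shiftI.
rewrite mem_filter shiftI // andbT /nonspecial_index !shift //.
by apply/asboolP; split.
Qed.

Theorem theorem1p2 (R : realType) :
  exists (C : R) (N0 : int), 0 < C /\
    forall N : int, N0 <= N ->
      (#|` fset_set (nonspecial_pairs N) |)%:R
        <= C * (N%:~R `^ (3 / 2)) * ln (N%:~R).
Proof.
have [C C0 [n0 H]] := sum_nonspecial_index_le R.
exists C, n0%:Z; split=> // -[n|//]; rewrite lez_nat => n0n.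
rewrite -[n%:~R]/(n%:R).
have -> : n%:R `^ (3 / 2) = n%:R * Num.sqrt n%:R :> R.
  have [->|n1] := posnP n; first by rewrite mul0r powR0 // mulf_neq0 // invr_eq0.
  rewrite (_ : 3 / 2 = 1 + 2^-1); last by field.
  rewrite powRD; last by rewrite pnatr_eq0 -lt0n n1 implybT.
  by rewrite powRr1 // powR12_sqrt.
apply: le_trans (H n n0n); rewrite -natr_sum ler_nat.
exact: card_nonspecial_pairs_le.
Qed.
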